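(* Let $G$ be a finitely generated group with finitely generated subgroup $H$, and let $X$ be a nontrivial $H$-almost invariant subset of $G$. If $S(X)$ is not equal to $G$, then $G$ splits over a subgroup of $S(X)$.
   Context: For $H\le G$, a subset of $G$ is $H$-finite if it lies in a union of finitely many cosets $Hg$; $X^*=G\setminus X$. $X\subset G$ is $H$-almost invariant if $hX=X$ for all $h\in H$ and, for every $g\in G$, the symmetric difference of $X$ and $Xg$ is $H$-finite; it is nontrivial if neither $X$ nor $X^*$ is $H$-finite. Two almost invariant sets $X$ (over $H$), $Y$ (over $K$) are equivalent if their symmetric difference is $H$-finite; they cross if none of the four sets $X\cap Y$, $X^*\cap Y$, $X\cap Y^*$, $X^*\cap Y^*$ is $H$-finite (for nontrivial sets, equivalently $K$-finite). A splitting of $G$ over $K$ is an expression $G=A*_KB$ with $A\ne K\ne B$, or an HNN extension $G=A*_K$; $G$ splits over $K$ if it has such a splitting. If $T$ is the corresponding tree with $G$-action, $s$ an oriented edge with stabiliser $K$, $v$ an endpoint of $s$ and $Y_s$ the set of vertices of the component of $T$ minus the interior of $s$ containing the terminal vertex of $s$, then $\{g\in G:gv\in Y_s\}$ and its complement are the $K$-almost invariant sets associated to the splitting. Definition of $S(X)$. Let $E=\{gX,gX^*:g\in G\}$, $\overline U=\{U,U^*\}$ and $\overline E=\{\overline U:U\in E\}$. The cross-connected components (CCCs) of $\overline E$ are the classes of the equivalence relation generated by crossing; $G$ acts on the set of CCCs. If $X$ is isolated, i.e. crosses no element of $E$, then $X$ is first replaced by an equivalent set which is associated to a splitting of $G$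 and all of whose translates are nested (for any translates $U$, $V$ of it one of the four sets $U\cap V,U^*\cap V,U\cap V^*,U^*\cap V^*$ is empty); this is always possible, and in this case each CCC is a single pair $\overline U$. $S(X)$ is the stabiliser in $G$ of the CCC which contains $\overline X$. (It is the group of the $V_0$-vertex of the regular neighbourhood $\Gamma(X:G)$ of $X$.) *)

(* Defs.v *)
From HB Require Import structures.
From mathcomp Require Import all_boot.
From mathcomp Require Import boolp classical_sets.
From Stdlib Require Import Relation_Operators.

Set Implicit Arguments.
Unset Strict Implicit.
Unset Printing Implicit Defensive.

Local Open Scope group_scope.
Local Open Scope classical_set_scope.

(* A [groupType] is a possibly infinite group; its subsets and subgroups are
   classical sets. *)
Section Subsets.
Variable G : groupType.
Implicit Types (H K A B X Y : set G) (g : G).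

Definition is_subgroup H : Prop := group_closed [in H].

Definition generated A : set G := smallest is_subgroup A.

Definition fin_gen H : Prop := exists s : seq G, H = generated [set` s].

Definition ltrans g X : set G := [set g * x | x in X].

Definition rtrans X g : set G := [set x * g | x in X].

(* g H g^-1, the group over which g X is almost invariant when X is almost
   invariant over H *)
Definition conj_sub g H : set G := [set g * h * g^-1 | h in H].

(* X is H-finite *)
Definition finite_over H X : Prop :=
  exists s : seq G, X `<=` \bigcup_(g in [set` s]) rtrans H g.

Definition almost_invariant H X : Prop :=
  (forall h, H h -> ltrans h X = X) /\
  (forall g, finite_over H (X `+` rtrans X g)).

Definition nontrivial_over H X : Prop :=
  ~ finite_over H X /\ ~ finite_over H (~` X).

(* X is almost invariant over H, Y over any subgroup *)
Definition ai_equiv H X Y : Prop := finite_over H (X `+` Y).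

Definition crosses H X Y : Prop :=
  [/\ ~ finite_over H (X `&` Y), ~ finite_over H (~` X `&` Y),
      ~ finite_over H (X `&` ~` Y) & ~ finite_over H (~` X `&` ~` Y)].

Definition nested X Y : Prop :=
  [\/ X `&` Y = set0, ~` X `&` Y = set0,
      X `&` ~` Y = set0 | ~` X `&` ~` Y = set0].

(* E *)
Definition translates X : set (set G) :=
  [set U | exists g, U = ltrans g X \/ U = ltrans g (~` X)].

Definition isolated H X : Prop :=
  forall V, translates X V -> ~ crosses H X V.

End Subsets.

Section CrossConnectedComponents.
Variable G : groupType.
Implicit Types (H X U : set G) (P Q : set (set G)).

(* The unordered pair {U, U^*} *)
Definition bar U : set (set G) := [set U; ~` U].

Definition bar_translates X : set (set (set G)) :=
  [set bar U | U in translates X].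

(* Crossing of two elements of E-bar.  The translates g X and g X^* are almost
   invariant over g H g^-1, so this is the group that measures finiteness. *)
Definition bar_crosses H X P Q : Prop :=
  exists g U V,
    [/\ U = ltrans g X \/ U = ltrans g (~` X), translates X V,
        P = bar U, Q = bar V & crosses (conj_sub g H) U V].

(* The cross-connected component of P, for P in E-bar *)
Definition ccc H X P : set (set (set G)) :=
  [set Q | bar_translates X Q /\ clos_refl_sym_trans _ (bar_crosses H X) P Q].

Definition act_pair (g : G) P : set (set G) := [set ltrans g U | U in P].

Definition stab_ccc H X : set G :=
  [set g | [set act_pair g P | P in ccc H X (bar X)] = ccc H X (bar X)].

End CrossConnectedComponents.

Section Splittings.
Variable G : groupType.

Definition hom_on (L : groupType) (A : set G) (f : G -> L) : Prop :=
  forall x y, A x -> A y -> f (x * y) = f x * f y.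

(* G = A *_K B : G is the pushout of the inclusions of K in A and in B.  The
   values of f and h outside A and B are irrelevant. *)
Definition is_amalgam (A B K : set G) : Prop :=
  [/\ is_subgroup A, is_subgroup B & is_subgroup K] /\
  [/\ K `<=` A, K `<=` B &
      forall (L : groupType) (f h : G -> L),
        hom_on A f -> hom_on B h -> (forall k, K k -> f k = h k) ->
        exists! F : G -> L,
          [/\ hom_on setT F, (forall a, A a -> F a = f a) &
              (forall b, B b -> F b = h b)]].

(* G = A *_K with stable letter t, where k |-> k ^ t = t^-1 k t is the second
   embedding of K in A *)
Definition is_hnn (A K : set G) (t : G) : Prop :=
  [/\ is_subgroup A, is_subgroup K, K `<=` A & forall k, K k -> A (k ^ t)] /\
  (forall (L : groupType) (f : G -> L) (u : L),
     hom_on A f -> (forall k, K k -> f (k ^ t) = f k ^ u) ->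
     exists! F : G -> L,
       [/\ hom_on setT F, (forall a, A a -> F a = f a) & F t = u]).

Inductive splitting_data : Type :=
| Amalgam of set G & set G & set G
| Hnn of set G & set G & G.

Definition is_splitting (D : splitting_data) : Prop :=
  match D with
  | Amalgam A B K => [/\ is_amalgam A B K, A <> K & K <> B]
  | Hnn A K t => is_hnn A K t
  end.

Definition edge_group (D : splitting_data) : set G :=
  match D with
  | Amalgam _ _ K => K
  | Hnn _ K _ => K
  end.

Definition splits_over (K : set G) : Prop :=
  exists D, is_splitting D /\ edge_group D = K.

(* The Bass-Serre tree.  Vertices are the cosets g A (tagged true) and, for an
   amalgam, g B (tagged false).  Edges are the cosets g K; the edge g K goes
   from g A to g B for an amalgam and from g A to g t A for an HNN extension.
   Edges are given by representatives. *)
Definition vertex : Type := (bool * set G)%type.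

Definition act_vertex (g : G) (v : vertex) : vertex := (v.1, ltrans g v.2).

Definition edge (D : splitting_data) (g : G) : set G :=
  ltrans g (edge_group D).

Definition edge_stab (D : splitting_data) (g : G) : set G :=
  [set x | ltrans x (edge D g) = edge D g].

(* edge_end D true g and edge_end D false g are the terminal and the initial
   vertex of the edge g K *)
Definition edge_end (D : splitting_data) (b : bool) (g : G) : vertex :=
  match D with
  | Amalgam A B _ => if b then (false, ltrans g B) else (true, ltrans g A)
  | Hnn A _ t => (true, ltrans (if b then g * t else g) A)
  end.

Definition adj_avoiding (D : splitting_data) (g0 : G) (v w : vertex) : Prop :=
  exists g b, [/\ edge D g <> edge D g0, v = edge_end D b g &
                  w = edge_end D (~~ b) g].

(* Y_s, for s the edge g0 K oriented towards edge_end D b g0 *)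
Definition half_tree (D : splitting_data) (g0 : G) (b : bool) : set vertex :=
  [set v | clos_refl_trans _ (adj_avoiding D g0) (edge_end D b g0) v].

Definition associated (D : splitting_data) (Z : set G) : Prop :=
  exists g0 b c, edge_stab D g0 = edge_group D /\
    let Zs := [set g | half_tree D g0 b (act_vertex g (edge_end D c g0))] in
    Z = Zs \/ Z = ~` Zs.

(* [is_S H X S] : S is S(X), for X almost invariant over H.  If X is isolated,
   X is first replaced by a suitable Z; this involves a choice, so S(X) is
   rendered as a relation that holds for every admissible choice. *)
Definition is_S (H X S : set G) : Prop :=
  (~ isolated H X /\ S = stab_ccc H X) \/
  (isolated H X /\
   exists (D : splitting_data) (Z : set G),
     [/\ is_splitting D, associated D Z, ai_equiv H X Z,
         (forall U V, translates Z U -> translates Z V -> nested U V) &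
         S = stab_ccc (edge_group D) Z]).

End Splittings.

(* Main.v *)
Require Import Defs.
From mathcomp Require Import all_boot.
From mathcomp Require Import boolp classical_sets.
From Stdlib Require Import Relation_Operators.

(** Suppose first that [X] is isolated and has been replaced by a set [Z]
    associated to an edge of the Bass-Serre tree of a splitting.  An element of
    the edge group fixes that edge, hence the half-tree which defines [Z], hence
    [Z] itself ([associated_stab]).  So the edge group lies in [S], and the given
    splitting is the one required.

    Suppose now that [X] crosses one of its translates.  Subsets of [G] are
    viewed in the Cayley graph of a finite generating set, and a set is small
    with respect to a translate [U] of [X] or of its complement when it lies
    within bounded distance of the boundary of [U].  Write [U <= V] when [U]
    minus [V] is small.  This is a preorder reversed by complementation
    ([small_transfer]), two translates cross exactly when they are incomparable
    even after complementation, and [U <= V <= U] forces [U] and [V] to cross a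
    common translate, hence to be in the same cross-connected component.
    Therefore each translate [V] has every component other than its own on
    exactly one of its two sides.  Two components have the same direction, seen
    from a third one, when they are on the same side of each of its members.
    Seen from [P] and from [Q], the direction towards the other one together
    cover everything ([directions_cover]), so directions are nested like the
    half-trees of a tree.

    The finite generation of [H] turns this into a tree: up to the action of
    [H], only finitely many translates of [X] have four nonempty corners with
    [X] ([four_corners_orbits]), whence only finitely many translates lie between
    two given ones ([between_finite]), and finitely many edges between two
    vertices.  The action of [G] has no fixed vertex: if some translate of [X]
    is in another component, there are other components on both sides of [X]
    ([component_on_each_side]), since otherwise deep points on one side would
    all belong to one coset of the stabiliser of the component, which would then
    be [G].  A translate on each side yields an element [a] which moves one side
    of [X] strictly into itself.

    Let [C] be the direction from [X] towards [a X], and [K] its stabiliser.  A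
    direction determines the component from which it is seen, so [K] fixes the
    component of [X] and lies in [S].  The translates of [C] are the half-trees
    of a tree with one orbit of edges; the stabilisers of the two ends of the
    edge [C] are the vertex groups.  If the ends are in different orbits then
    [G] is an amalgam over [K], and otherwise an HNN extension.  The universal
    properties follow from ping-pong on the two sides of the edge, and
    generation from the finiteness of the number of edges between two vertices.
    The element [a] moves both ends, so that the amalgam is proper. *)

Set Implicit Arguments.
Unset Strict Implicit.
Unset Printing Implicit Defensive.

Local Open Scope group_scope.
Local Open Scope classical_set_scope.

(** * Subgroups and translates *)

(* Left-associates a group word and cancels adjacent inverse letters. *)
Ltac grp := repeat (progress
  rewrite ?invgM ?invgK ?invg1 ?mul1g ?mulg1 ?mulgA ?mulVg ?mulgV
          ?mulgK ?mulgVK).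

Section Subgroups.
Variable G : groupType.
Implicit Types (M A : set G) (g x y : G).

Lemma is_subgroupP M :
  is_subgroup M <-> M 1 /\ (forall x y, M x -> M y -> M (x * y^-1)).
Proof.
split=> [[M1 MB]|[M1 MB]]; split.
- by rewrite inE in M1.
- by move=> x y Mx My; have := MB x y; rewrite !inE; apply.
- by rewrite inE.
- by move=> x y; rewrite !inE; apply: MB.
Qed.

Lemma subgroup1 M : is_subgroup M -> M 1.
Proof. by case/is_subgroupP. Qed.

Lemma subgroupV M x : is_subgroup M -> M x -> M x^-1.
Proof. by case/is_subgroupP=> M1 MB Mx; rewrite -[x^-1]mul1g; apply: MB. Qed.

Lemma subgroupM M x y : is_subgroup M -> M x -> M y -> M (x * y).
Proof.
move=> sM Mx My; have [_ MB] := (is_subgroupP M).1 sM.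
by rewrite -[y]invgK; apply: MB => //; apply: subgroupV.
Qed.

Lemma generated_min A M : is_subgroup M -> A `<=` M -> generated A `<=` M.
Proof. by move=> sM AM x; apply; split. Qed.

Lemma ltransE g A x : ltrans g A x <-> A (g^-1 * x).
Proof.
split=> [[y Ay <-]|Ax]; first by rewrite mulKg.
by exists (g^-1 * x) => //; rewrite mulVKg.
Qed.

Lemma rtransE g A x : rtrans A g x <-> A (x * g^-1).
Proof.
split=> [[y Ay <-]|Ax]; first by rewrite mulgK.
by exists (x * g^-1) => //; rewrite mulgVK.
Qed.

Lemma ltrans1 A : ltrans 1 A = A.
Proof. by apply/seteqP; split=> x; rewrite ltransE; grp. Qed.

Lemma ltransM x y A : ltrans x (ltrans y A) = ltrans (x * y) A.
Proof. by apply/seteqP; split=> z; rewrite !ltransE; grp. Qed.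

Lemma ltransC x A : ltrans x (~` A) = ~` ltrans x A.
Proof.
apply/seteqP; split=> z; first by rewrite ltransE => nA /ltransE.
by move=> nA; apply/ltransE => Az; apply/nA/ltransE.
Qed.

Lemma ltransVK g A : ltrans g^-1 (ltrans g A) = A.
Proof. by rewrite ltransM mulVg ltrans1. Qed.

End Subgroups.

(** * Ping-pong criteria for amalgams and HNN extensions *)

Section Homomorphisms.
Variables G L : groupType.
Implicit Types (F f h : G -> L) (R : G -> L -> Prop).

Lemma hom_on1 F : hom_on setT F -> F 1 = 1.
Proof. by move=> hF; apply: (mulgI (F 1)); rewrite -hF // !mulg1. Qed.

Lemma hom_onV F x : hom_on setT F -> F x^-1 = (F x)^-1.
Proof.
by move=> hF; apply: (mulgI (F x)); rewrite -hF // !mulgV hom_on1.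
Qed.

Lemma hom_on_sub (A : set G) f :
  is_subgroup A -> hom_on A f -> f 1 = 1 /\ (forall a, A a -> f a^-1 = (f a)^-1).
Proof.
move=> sA hf; have A1 := subgroup1 sA.
have f1 : f 1 = 1 by apply: (mulgI (f 1)); rewrite -hf // !mulg1.
split=> // a Aa; apply: (mulgI (f a)).
by rewrite -hf // ?mulgV //; apply: subgroupV.
Qed.

Lemma hom_equalizer F F' :
  hom_on setT F -> hom_on setT F' -> is_subgroup [set x | F x = F' x].
Proof.
move=> hF hF'; apply/is_subgroupP; split=> [|x y /= ex ey].
  by rewrite /= !hom_on1.
by rewrite hF // hF' // !hom_onV // ex ey.
Qed.

(** [R] is closed under products and surjects onto [G]; a relation of this kind
    whose fibre over [1] is trivial is the graph of a homomorphism.  It is easier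
    to exhibit such a relation than to choose normal forms. *)
Lemma hom_of_relation R :
    R 1 1 -> (forall g l g' l', R g l -> R g' l' -> R (g * g') (l * l')) ->
    (forall g, exists l, R g l) -> (forall l, R 1 l -> l = 1) ->
  exists F, hom_on setT F /\ forall g l, R g l -> F g = l.
Proof.
move=> R1 RM Rtot Rker.
have Runiq g l l' : R g l -> R g l' -> l = l'.
  move=> Rl Rl'; have [m Rm] := Rtot g^-1.
  have mK k : R g k -> m * k = 1.
    by move=> /(RM _ _ _ _ Rm); rewrite mulVg => /Rker.
  by apply: (mulgI m); rewrite !mK.
have [F RF] : {F : G -> L & forall g, R g (F g)}.
  by exists (fun g => sval (cid (Rtot g))) => g; case: cid.
exists F; split=> [x y _ _|g l]; last exact: Runiq.
exact: Runiq (RF _) (RM _ _ _ _ (RF _) (RF _)).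
Qed.

End Homomorphisms.

(** [P] and [Q] are to be thought of as the edges other than the base edge on
    the two sides of it, [A] and [B] as the stabilisers of its two ends: an
    element of [A] outside [K] moves everything not on the side of [A] to
    the side of [A]. *)
Section AmalgamPingPong.
Variable G : groupType.
Variables A B K P Q : set G.
Hypothesis sA : is_subgroup A.
Hypothesis sB : is_subgroup B.
Hypothesis sK : is_subgroup K.
Hypothesis KA : K `<=` A.
Hypothesis KB : K `<=` B.
Hypothesis genAB : forall M, is_subgroup M -> A `<=` M -> B `<=` M -> forall g, M g.
Hypothesis disjPQ : forall g, P g -> ~ Q g.
Hypothesis disjKP : forall g, K g -> ~ P g.
Hypothesis disjKQ : forall g, K g -> ~ Q g.
Hypothesis pingA : forall a g, A a -> ~ K a -> ~ Q g -> Q (a * g).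
Hypothesis pongB : forall b g, B b -> ~ K b -> ~ P g -> P (b * g).

Section Words.
Variables (L : groupType) (f h : G -> L).
Hypothesis hf : hom_on A f.
Hypothesis hh : hom_on B h.
Hypothesis fh : forall k, K k -> f k = h k.

(** The values in [G] and in [L] of one and the same word.  The guards [~ Q g]
    and [~ P g] play the part of reducedness: a word that already begins with a
    nontrivial letter of [A] has its value in [Q]. *)
Inductive amalgam_word : G -> L -> Prop :=
| AmalgamNil : amalgam_word 1 1
| AmalgamL a g l : A a -> ~ Q g -> amalgam_word g l ->
    amalgam_word (a * g) (f a * l)
| AmalgamR b g l : B b -> ~ P g -> amalgam_word g l ->
    amalgam_word (b * g) (h b * l).

(** The guards do not restrict the pairs obtained: when one fails, ping-pong
    shows that the first letter lies on the same side as the new one, or in [K],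
    where [f] and [h] agree; the two letters merge. *)
Lemma amalgam_word_closed g l : amalgam_word g l ->
  (forall a, A a -> amalgam_word (a * g) (f a * l)) /\
  (forall b, B b -> amalgam_word (b * g) (h b * l)).
Proof.
have K1 := subgroup1 sK.
elim=> [|{g l}a g l Aa nQg Rg [IHA IHB]|{g l}b g l Bb nPg Rg [IHA IHB]].
- split=> x Xx; first exact: AmalgamL Xx (disjKQ K1) AmalgamNil.
  exact: AmalgamR Xx (disjKP K1) AmalgamNil.
- split=> [a' Aa'|b Bb].
    by rewrite !mulgA -hf //; apply: AmalgamL => //; apply: subgroupM.
  have [Pag|nPag] := pselect (P (a * g)); last first.
    by apply: AmalgamR => //; apply: AmalgamL.
  have [Ka|nKa] := pselect (K a); last by case: (disjPQ Pag); apply: pingA.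
  by rewrite !mulgA fh // -hh; [apply: IHB; apply: subgroupM; rewrite // ; apply: KB | | apply: KB].
- split=> [a Aa|b' Bb']; last first.
    by rewrite !mulgA -hh //; apply: AmalgamR => //; apply: subgroupM.
  have [Qbg|nQbg] := pselect (Q (b * g)); last first.
    by apply: AmalgamL => //; apply: AmalgamR.
  have [Kb|nKb] := pselect (K b).
    by rewrite !mulgA -fh // -hf; [apply: IHA; apply: subgroupM; rewrite // ; apply: KA | | apply: KA].
  by case: (disjPQ (pongB Bb nKb nPg)).
Qed.

(** A word whose value is in [K] has all its letters in [K], because a first
    letter outside [K] would put the value in [P] or [Q]. *)
Lemma amalgam_word_ker g l : amalgam_word g l -> K g -> l = f g.
Proof.
have [f1 _] := hom_on_sub sA hf.
elim=> [|{g l}a g l Aa nQg _ IH|{g l}b g l Bb nPg _ IH] Kg; first by rewrite f1.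
- have [Ka|nKa] := pselect (K a); last by case: (disjKQ Kg); apply: pingA.
  have Kg' : K g by rewrite -[g](mulKg a); apply: subgroupM => //; apply: subgroupV.
  by rewrite IH // hf //; apply: KA.
- have [Kb|nKb] := pselect (K b); last by case: (disjKP Kg); apply: pongB.
  have Kg' : K g by rewrite -[g](mulKg b); apply: subgroupM => //; apply: subgroupV.
  by rewrite IH // -fh // hf //; apply: KA.
Qed.

Lemma amalgam_hom : exists F : G -> L,
  [/\ hom_on setT F, (forall a, A a -> F a = f a) & (forall b, B b -> F b = h b)].
Proof.
have [f1 fV] := hom_on_sub sA hf; have [h1 hV] := hom_on_sub sB hh.
have inA a : A a -> amalgam_word a (f a).
  by move=> Xx; have := (amalgam_word_closed AmalgamNil).1 _ Xx; rewrite !mulg1.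
have inB b : B b -> amalgam_word b (h b).
  by move=> Xx; have := (amalgam_word_closed AmalgamNil).2 _ Xx; rewrite !mulg1.
have wM g l g' l' : amalgam_word g l -> amalgam_word g' l' ->
    amalgam_word (g * g') (l * l').
  move=> + w'; elim=> [|{g l}a g l Aa _ _ /amalgam_word_closed[+ _]
                       |{g l}b g l Bb _ _ /amalgam_word_closed[_]].
  - by rewrite !mul1g.
  - by rewrite -!mulgA; apply.
  - by rewrite -!mulgA; apply.
have [||||F [hF wF]] := @hom_of_relation G L amalgam_word.
- exact: AmalgamNil.
- exact: wM.
- move=> g.
  suff [l [wl _]] : [set x | exists l, amalgam_word x l /\ amalgam_word x^-1 l^-1] g.
    by exists l.
  apply: genAB g.
  + apply/is_subgroupP; split=> [|x y [l [w1 w2]] [m [w3 w4]]] /=.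
      by exists 1; rewrite !invg1; split; apply: AmalgamNil.
    exists (l * m^-1); split; first exact: wM.
    by rewrite !invgM !invgK; apply: wM.
  + by move=> a Aa; exists (f a); rewrite -fV //; split; apply/inA => //; apply: subgroupV.
  + by move=> b Bb; exists (h b); rewrite -hV //; split; apply/inB => //; apply: subgroupV.
- by move=> l /amalgam_word_ker ->; [exact: f1 | exact: subgroup1].
- by exists F; split=> // x ?; apply: wF; [apply: inA | apply: inB].
Qed.

End Words.

Lemma amalgam_of_pingpong : is_amalgam A B K.
Proof.
split; split=> // L f h hf hh fh.
have [F [hF Ff Fh]] := amalgam_hom hf hh fh.
exists F; split=> // F' [hF' Ff' Fh']; apply/funext=> g.
suff: [set x | F x = F' x] g by [].
apply: genAB g; first exact: hom_equalizer.
- by move=> a Aa /=; rewrite Ff // Ff'.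
- by move=> b Bb /=; rewrite Fh // Fh'.
Qed.

End AmalgamPingPong.

(** [P] and [Q] are to be thought of as the vertices beyond the edges [K] and
    [t^-1 K], the outgoing and the incoming one at the vertex with stabiliser
    [A]. *)
Section HnnPingPong.
Variable G : groupType.
Variables (A K P Q : set G) (t : G).
Hypothesis sA : is_subgroup A.
Hypothesis sK : is_subgroup K.
Hypothesis KA : K `<=` A.
Hypothesis KtA : forall k, K k -> A (k ^ t).
Hypothesis genAt : forall M, is_subgroup M -> A `<=` M -> M t -> forall g, M g.
Hypothesis disjAP : forall a, A a -> ~ P a.
Hypothesis disjAQ : forall a, A a -> ~ Q a.
Hypothesis pingt : forall g, ~ Q g -> P (t * g).
Hypothesis pongt : forall g, ~ P g -> Q (t^-1 * g).
Hypothesis pingPP : forall a g, A a -> P g -> P (a * g) -> K a.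
Hypothesis pingQQ : forall a g, A a -> Q g -> Q (a * g) -> K (a ^ t^-1).
Hypothesis pingPQ : forall a g, A a -> P g -> ~ Q (a * g).

Section Words.
Variables (L : groupType) (f : G -> L) (u : L).
Hypothesis hf : hom_on A f.
Hypothesis fu : forall k, K k -> f (k ^ t) = f k ^ u.

(** As for amalgams, the guards replace Britton reducedness: a value in [Q] can
    only come from a word whose first stable letter is [t^-1]. *)
Inductive hnn_word : G -> L -> Prop :=
| HnnNil : hnn_word 1 1
| HnnBase a g l : A a -> hnn_word g l -> hnn_word (a * g) (f a * l)
| HnnStable g l : ~ Q g -> hnn_word g l -> hnn_word (t * g) (u * l)
| HnnStableV g l : ~ P g -> hnn_word g l -> hnn_word (t^-1 * g) (u^-1 * l).

(** The pinch [t a t^-1]: for the value to be in [Q], the letter [a] must lie in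
    the conjugate [K ^ t], and then the relation between [f] and [u] removes
    both stable letters. *)
Lemma hnn_word_back g l : hnn_word g l -> forall a, A a -> Q (a * g) ->
  hnn_word (t * (a * g)) (u * (f a * l)).
Proof.
elim=> [|{g l}b g l Ab Rg IH|{g l}g l nQg Rg IH|{g l}g l nPg Rg IH] a Aa Qag.
- by case: (disjAQ Aa); rewrite -[a]mulg1.
- rewrite (mulgA a) (mulgA (f a)) -hf //; apply: IH; last by rewrite -mulgA.
  exact: subgroupM.
- by case: (@pingPQ a (t * g)) => //; apply: pingt.
- have Kat := pingQQ Aa (pongt nPg) Qag.
  have := HnnBase (KA Kat) Rg; congr hnn_word.
    by rewrite conjgE; grp.
  have -> : f a = f (a ^ t^-1) ^ u by rewrite -fu // conjgKV.
  by rewrite conjgE; grp.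
Qed.

Lemma hnn_word_forth g l : hnn_word g l -> forall a, A a -> P (a * g) ->
  hnn_word (t^-1 * (a * g)) (u^-1 * (f a * l)).
Proof.
elim=> [|{g l}b g l Ab Rg IH|{g l}g l nQg Rg IH|{g l}g l nPg Rg IH] a Aa Pag.
- by case: (disjAP Aa); rewrite -[a]mulg1.
- rewrite (mulgA a) (mulgA (f a)) -hf //; apply: IH; last by rewrite -mulgA.
  exact: subgroupM.
- have Ka := pingPP Aa (pingt nQg) Pag.
  have := HnnBase (KtA Ka) Rg; rewrite fu //; congr hnn_word.
    by rewrite conjgE; grp.
  by rewrite conjgE; grp.
- case: (@pingPQ a^-1 (a * (t^-1 * g))) => //; first exact: subgroupV.
  by rewrite mulKg; apply: pongt.
Qed.

Lemma hnn_word_stable g l : hnn_word g l -> hnn_word (t * g) (u * l).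
Proof.
have [f1 _] := hom_on_sub sA hf => w.
have [Qg|] := pselect (Q g); last by move=> nQ; apply: HnnStable.
have := hnn_word_back w (subgroup1 sA).
by rewrite f1 !mul1g; apply.
Qed.

Lemma hnn_word_stableV g l : hnn_word g l -> hnn_word (t^-1 * g) (u^-1 * l).
Proof.
have [f1 _] := hom_on_sub sA hf => w.
have [Pg|] := pselect (P g); last by move=> nP; apply: HnnStableV.
have := hnn_word_forth w (subgroup1 sA).
by rewrite f1 !mul1g; apply.
Qed.

Lemma hnn_word_ker g l : hnn_word g l -> A g -> l = f g.
Proof.
have [f1 _] := hom_on_sub sA hf.
elim=> [|{g l}b g l Ab _ IH|{g l}g l nQg _ _|{g l}g l nPg _ _] Ag.
- by rewrite f1.
- have Ag' : A g by rewrite -[g](mulKg b); apply: subgroupM => //; apply: subgroupV.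
  by rewrite IH // hf.
- by case: (disjAP Ag); apply: pingt.
- by case: (disjAQ Ag); apply: pongt.
Qed.

Lemma hnn_hom : exists F : G -> L,
  [/\ hom_on setT F, (forall a, A a -> F a = f a) & F t = u].
Proof.
have [f1 fV] := hom_on_sub sA hf.
have inA a : A a -> hnn_word a (f a).
  by move=> /HnnBase/(_ HnnNil); rewrite !mulg1.
have int : hnn_word t u by have := hnn_word_stable HnnNil; rewrite !mulg1.
have intV : hnn_word t^-1 u^-1 by have := hnn_word_stableV HnnNil; rewrite !mulg1.
have wM g l g' l' : hnn_word g l -> hnn_word g' l' -> hnn_word (g * g') (l * l').
  move=> + w'; elim=> [|{g l}a g l Aa _|{g l}g l _ _|{g l}g l _ _]; rewrite -?mulgA.
  - by rewrite !mul1g.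
  - exact: HnnBase.
  - exact: hnn_word_stable.
  - exact: hnn_word_stableV.
have [||||F [hF wF]] := @hom_of_relation G L hnn_word.
- exact: HnnNil.
- exact: wM.
- move=> g.
  suff [l [wl _]] : [set x | exists l, hnn_word x l /\ hnn_word x^-1 l^-1] g.
    by exists l.
  apply: genAt g.
  + apply/is_subgroupP; split=> [|x y [l [w1 w2]] [m [w3 w4]]] /=.
      by exists 1; rewrite !invg1; split; apply: HnnNil.
    exists (l * m^-1); split; first exact: wM.
    by rewrite !invgM !invgK; apply: wM.
  + by move=> a Aa; exists (f a); rewrite -fV //; split; apply/inA => //; apply: subgroupV.
  + by exists u.
- by move=> l /hnn_word_ker ->; [exact: f1 | exact: subgroup1].
- by exists F; split=> // [a ?|]; apply: wF; [apply: inA|].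
Qed.

End Words.

Lemma hnn_of_pingpong : is_hnn A K t.
Proof.
split; first by split.
move=> L f u hf fu; have [F [hF Ff Ft]] := hnn_hom hf fu.
exists F; split=> // F' [hF' Ff' Ft']; apply/funext=> g.
suff: [set x | F x = F' x] g by [].
apply: genAt g; first exact: hom_equalizer.
- by move=> a Aa /=; rewrite Ff // Ff'.
- by rewrite /= Ft Ft'.
Qed.

End HnnPingPong.

(** * Splittings from nested walls *)

(** Half-spaces [wall g], the translates of [C], any two of them nested.  The
    points [p] and [q] are the two ends of the edge [C]: this edge is the only one
    that separates them, which also excludes inversions.  Vertices of the tree
    are the classes of points not separated by any wall. *)
Section Walls.
Variables (G : groupType) (T : Type) (act : G -> T -> T).
Variables (C : set T) (p q : T).

Definition wall g : set T := [set x | C (act g^-1 x)].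
Definition wall_stab : set G := [set g | wall g = C].
Definition separates g x y : Prop := ~ (wall g x <-> wall g y).
Definition unseparated x y : Prop := forall g, wall g x <-> wall g y.
Definition vertex_stab x : set G := [set g | unseparated x (act g x)].

Hypothesis act1 : forall x, act 1 x = x.
Hypothesis actM : forall g h x, act (g * h) x = act g (act h x).
Hypothesis wall_nested : forall g,
  [\/ wall g `<=` C, C `<=` wall g, (forall x, C x -> ~ wall g x) |
      (forall x, C x \/ wall g x)].
Hypothesis nCp : ~ C p.
Hypothesis Cq : C q.
Hypothesis edge_wall : forall g, separates g p q -> wall_stab g.
Hypothesis finite_walls : forall x y, exists l : seq G,
  forall g, separates g x y -> exists2 g', g' \in l & wall g = wall g'.

Local Notation K := wall_stab.
Local Notation A := (vertex_stab p).
Local Notation B := (vertex_stab q).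

Lemma wall_act g h x : wall g (act h x) = wall (h^-1 * g) x.
Proof. by rewrite /wall /= -actM; grp. Qed.

Lemma wall1 : wall 1 = C.
Proof. by apply/seteqP; split=> x; rewrite /wall /= invg1 act1. Qed.

Lemma wallK g x : wall g (act g x) = C x.
Proof. by rewrite wall_act mulVg wall1. Qed.

Lemma wall_eqM h u w : wall u = wall w -> wall (h * u) = wall (h * w).
Proof.
move=> uw; apply/seteqP.
by split=> x; rewrite -[h]invgK -!wall_act uw.
Qed.

Lemma wall_eqMI h u w : wall (h * u) = wall (h * w) -> wall u = wall w.
Proof. by move=> /(wall_eqM h^-1); rewrite !mulKg. Qed.

Lemma wall_stabE g : K g <-> wall g = wall 1.
Proof. by rewrite wall1. Qed.

Lemma is_subgroup_wall_stab : is_subgroup K.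
Proof.
apply/is_subgroupP; split=> [|x y]; rewrite !wall_stabE // => ex ey.
have eV : wall y^-1 = wall 1.
  by rewrite -[y^-1]mulg1 -[1 in RHS](mulVg y); apply: wall_eqM.
by rewrite -ex -[x in RHS]mulg1; apply: wall_eqM.
Qed.
Let sK := is_subgroup_wall_stab.

Lemma unseparated_sym x y : unseparated x y -> unseparated y x.
Proof. by move=> xy g; split=> /xy. Qed.

Lemma unseparated_trans y x z :
  unseparated x y -> unseparated y z -> unseparated x z.
Proof. by move=> xy yz g; split=> [/xy/yz|/yz/xy]. Qed.

Lemma unseparated_act h x y : unseparated x y -> unseparated (act h x) (act h y).
Proof. by move=> xy g; rewrite !wall_act; apply: xy. Qed.

Lemma is_subgroup_vertex_stab x : is_subgroup (vertex_stab x).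
Proof.
apply/is_subgroupP; split=> [|g h xg xh]; first by rewrite /vertex_stab /= act1.
apply: unseparated_trans xg _; rewrite actM; apply: unseparated_act.
by have := unseparated_act h^-1 xh; rewrite -actM mulVg act1 => /unseparated_sym.
Qed.

Lemma wall_nested2 u w :
  [\/ wall u `<=` wall w, wall w `<=` wall u,
      (forall x, wall w x -> ~ wall u x) | (forall x, wall w x \/ wall u x)].
Proof.
have e x : wall w x = C (act w^-1 x) by [].
have e' x : wall u x = wall (w^-1 * u) (act w^-1 x) by rewrite wall_act; grp.
case: (wall_nested (w^-1 * u)) => H; [apply: Or41|apply: Or42|apply: Or43|apply: Or44] => x;
  rewrite e e'; exact: H.
Qed.

Lemma edge_wall_act g : ~ (C (act g p) <-> C (act g q)) -> K g.
Proof.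
move=> ne; rewrite -[g]invgK; apply: subgroupV => //; apply: edge_wall.
by rewrite /separates /wall /= invgK.
Qed.

Lemma edge_wall2 g w : separates g (act w p) (act w q) -> wall g = wall w.
Proof.
rewrite /separates !wall_act => /edge_wall; rewrite wall_stabE => H.
by apply: (@wall_eqMI w^-1); rewrite mulVg.
Qed.

Lemma wall_stab_act k x : K k -> C (act k x) <-> C x.
Proof.
by move=> Kk; rewrite -(wallK k x) Kk.
Qed.

(** A wall separating [p] from its image under [K] would have to be nested with
    [C] in a way that makes it separate [p] from [q], so it would be [C]; but
    both points are on the same side of [C]. *)
Lemma wall_stab_fix_init : K `<=` A.
Proof.
suff sub k g : K k -> wall g (act k p) -> wall g p.
  move=> k Kk g; split; last exact: sub.
  rewrite wall_act => gp; apply: (sub k^-1); first exact: subgroupV.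
  by rewrite wall_act invgK mulVKg.
move=> Kk gkp; apply: contrapT => ngp.
have nCkp : ~ C (act k p) by rewrite wall_stab_act.
have edge u : ~ (wall u p <-> wall u q) -> wall u = C by apply: edge_wall.
case: (wall_nested g) => H.
- by apply/nCkp/H.
- by apply: nCkp; rewrite -(edge g) // => -[_]; move/(_ (H _ Cq)).
- have g'p : wall (k^-1 * g) p by rewrite -wall_act.
  case: nCp; rewrite -(edge (k^-1 * g)) // => -[/(_ g'p)].
  rewrite -wall_act => gkq; case: (H (act k q)) => //.
  by rewrite wall_stab_act.
- by case: (H p).
Qed.

Lemma wall_stab_fix_term : K `<=` B.
Proof.
suff sub k g : K k -> wall g q -> wall g (act k q).
  move=> k Kk g; split; first exact: sub.
  rewrite wall_act => gp; have := sub _ _ (subgroupV sK Kk) gp.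
  by rewrite wall_act invgK mulVKg.
move=> Kk gq; apply: contrapT => ngkq.
have Ckq : C (act k q) by rewrite wall_stab_act.
have edge u : ~ (wall u p <-> wall u q) -> wall u = C by apply: edge_wall.
case: (wall_nested g) => H.
- by apply: ngkq; rewrite (edge g) // => -[_ /(_ gq)/H].
- exact/ngkq/H.
- exact: H Cq gq.
- have ng'q : ~ wall (k^-1 * g) q by rewrite -wall_act.
  have g'p : wall (k^-1 * g) p.
    by rewrite -wall_act; case: (H (act k p)) => //; rewrite wall_stab_act.
  by apply: (ng'q); rewrite (edge (k^-1 * g)) // => -[/(_ g'p)/ng'q].
Qed.

(** Two different edges leaving the same vertex lead to disjoint half-trees: if
    one half-tree contained the other, its wall would separate the ends of the
    edge of the smaller one. *)
Lemma init_walls_disjoint a : A a -> ~ K a -> forall x, C x -> ~ wall a x.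
Proof.
have grow u : A u -> C `<=` wall u -> K u.
  move=> Au Cu; apply: edge_wall => -[_ H]; apply: nCp.
  by rewrite -(wallK u); apply: (Au u).1; apply: H; apply: Cu.
move=> Aa nKa; case: (wall_nested a) => // H; case: nKa; last 2 first.
- exact: grow.
- by case: (H p) => // /(Aa a).1; rewrite wallK.
rewrite -[a]invgK; apply: subgroupV => //; apply: grow.
  exact: subgroupV (is_subgroup_vertex_stab p) Aa.
by move=> x; have := H (act a x); rewrite wallK /wall /= invgK.
Qed.

Lemma term_walls_cover b : B b -> ~ K b -> forall x, C x \/ wall b x.
Proof.
have shrink u : B u -> wall u `<=` C -> K u.
  move=> Bu Cu; apply: edge_wall => -[_ H]; apply: nCp.
  by apply: Cu; apply: H; apply: (Bu u).2; rewrite wallK.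
move=> Bb nKb; case: (wall_nested b) => // H; case: nKb.
- exact: shrink.
- rewrite -[b]invgK; apply: subgroupV => //; apply: shrink.
    exact: subgroupV (is_subgroup_vertex_stab q) Bb.
  by move=> x bx; rewrite -(wallK b); apply: H; move: bx; rewrite /wall /= invgK.
- by case: (H q) => //; apply: (Bb b).2; rewrite wallK.
Qed.

Definition wall_end (e : bool) : T := if e then q else p.

Lemma wall_endE e : C (wall_end e) <-> e.
Proof. by case: e. Qed.

(** On the way from [x] to [y] the edge [w] is entered at its end on the side of
    [x], and no other edge is crossed twice.  If [g] separated [x] from that end
    but not from [y], the points [x], [y] and the two ends of [w] would occupy
    all four quadrants of [g] and [w], against nestedness. *)
Lemma separates_near_end x y w (e : bool) g :
    separates w x y -> (wall w x <-> e) ->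
    separates g x (act w (wall_end e)) ->
  separates g x y /\ wall g <> wall w.
Proof.
move=> wxy wxe gxz.
have wz : wall w (act w (wall_end e)) <-> e by rewrite wallK wall_endE.
have wz' : wall w (act w (wall_end (~~ e))) <-> ~~ e by rewrite wallK wall_endE.
have ngw : wall g <> wall w.
  by move=> gw; apply: gxz; rewrite gw wz wxe.
split=> // gxy.
have gzz' : wall g (act w (wall_end e)) <-> wall g (act w (wall_end (~~ e))).
  apply: contrapT => ne; apply: ngw; apply: edge_wall2.
  by case: (e) ne; rewrite /separates /wall_end /= => ne ?; apply: ne; tauto.
move: wz wz' gzz' gxz.
set z := act w (wall_end e); set z' := act w (wall_end (~~ e)).
move=> wz wz' gzz' gxz.
have gz : wall g z <-> ~ wall g x.
  by have := pselect (wall g z); have := pselect (wall g x); move: gxz; rewrite /separates; tauto.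
have wy : wall w y <-> ~ wall w x.
  by have := pselect (wall w y); have := pselect (wall w x); move: wxy; rewrite /separates; tauto.
have wn : (~~ e) <-> ~ e by split=> /negP.
case: (wall_nested2 g w) => H; have [gx|gx] := pselect (wall g x);
  have [ee|ee] := pselect e;
  have := H x; have := H y; have := H z; have := H z'; tauto.
Qed.

(** Connectedness of the tree.  A wall separating two vertices splits the way
    between them into two shorter ones, whose lengths are measured by the number
    of walls; the induction ends at pairs of vertices that no wall
    separates, which [M] is assumed to handle. *)
Lemma walls_generate M : is_subgroup M ->
    (forall b c w, unseparated (wall_end b) (act w (wall_end c)) -> M w) ->
  forall g, M g.
Proof.
move=> sM Madj.
suff conn n (l : seq G) : (size l < n)%N -> forall x y b c,
    (forall g, separates g (act x (wall_end b)) (act y (wall_end c)) ->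
       exists2 g', g' \in l & wall g = wall g') -> M (x^-1 * y).
  move=> g; have [l Hl] := finite_walls (act 1 p) (act g p).
  have := @conn (size l).+1 l (ltnSn _) 1 g false false Hl.
  by rewrite invg1 mul1g.
elim: n l => // n IH l ln x y b c Hl.
(* A separating wall [w], if there is one, cuts the way at the edge [w]. *)
have [[w wxy]|nsep] := pselect (exists w,
    separates w (act x (wall_end b)) (act y (wall_end c))); last first.
  apply: (Madj b c).
  have adj : unseparated (act x (wall_end b)) (act y (wall_end c)).
    by move=> g; apply: contrapT => ne; apply: nsep; exists g.
  by have := unseparated_act x^-1 adj; rewrite -!actM mulVg act1.
have [w0 w0l ww0] := Hl _ wxy.
pose l' := [seq g <- l | `[< wall g <> wall w >]].
have l'n : (size l' < n)%N.
  rewrite ltnS in ln; apply: leq_trans ln; rewrite size_filter.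
  rewrite -(count_predC (fun g => `[< wall g <> wall w >]) l).
  rewrite -[X in (X < _)%N]addn0 ltn_add2l -has_count.
  by apply/hasP; exists w0 => //=; apply/asboolPn; rewrite -ww0; apply.
(* [e] tells on which side of [w] the starting point is, hence which end of the
   edge [w] is reached first. *)
have [e we] : exists e : bool, wall w (act x (wall_end b)) <-> e.
  by exists `[< wall w (act x (wall_end b)) >]; rewrite asboolE.
rewrite -[x^-1 * y](_ : (x^-1 * w) * (w^-1 * y) = _); last by grp.
apply: subgroupM => //.
  apply: (IH l' l'n _ _ b e) => g /(separates_near_end wxy we)[gxy ngw].
  have [g' g'l gg'] := Hl _ gxy; exists g' => //.
  by rewrite mem_filter g'l andbT; apply/asboolP; rewrite -gg'.
apply: (IH l' l'n _ _ (~~ e) c) => g gwy.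
have wyx : separates w (act y (wall_end c)) (act x (wall_end b)).
  by rewrite /separates => H; apply: wxy; split => /H.
have we' : wall w (act y (wall_end c)) <-> ~~ e.
  have en : (~~ e) <-> ~ e by split=> /negP.
  move: wxy we; rewrite /separates.
  by have := pselect (wall w (act y (wall_end c))); have := pselect e; tauto.
have gyw : separates g (act y (wall_end c)) (act w (wall_end (~~ e))).
  by rewrite /separates => H; apply: gwy; split => /H.
have [gyx ngw] := separates_near_end wyx we' gyw.
have [g' g'l gg'] : exists2 g', g' \in l & wall g = wall g'.
  by apply: Hl => H; apply: gyx; split => /H.
by exists g' => //; rewrite mem_filter g'l andbT; apply/asboolP; rewrite -gg'.
Qed.

(** The far end of the edge is in a different orbit from the near end: ping-pong
    on the edges on either side of [C]. *)
Lemma amalgam_of_walls : (forall t, ~ unseparated q (act t p)) ->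
  is_amalgam A B K.
Proof.
move=> noadj; pose P : set G := [set g | ~ K g /\ C (act g p)].
pose Q : set G := [set g | ~ K g /\ ~ C (act g q)].
have sAp := is_subgroup_vertex_stab p; have sBq := is_subgroup_vertex_stab q.
have KCq g : K g -> C (act g q) by move=> Kg; rewrite wall_stab_act.
have KCp g : K g -> ~ C (act g p) by move=> Kg; rewrite wall_stab_act.
have nQ g : ~ Q g -> C (act g q).
  move=> nQg; apply: contrapT => nC; apply: nQg; split=> // Kg.
  exact/nC/KCq.
have nP g : ~ P g -> ~ C (act g p).
  by move=> nPg Cg; apply: nPg; split=> // Kg; apply: (KCp g).
apply: (@amalgam_of_pingpong _ A B K P Q) => //.
- exact: wall_stab_fix_init.
- exact: wall_stab_fix_term.
- move=> M sM AM BM; apply: walls_generate => // b c w; case: b c => -[] /=.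
  + exact: BM.
  + by move=> /noadj.
  + move=> pwq; case: (noadj w^-1); apply: unseparated_sym.
    by have := unseparated_act w^-1 pwq; rewrite -actM mulVg act1.
  + exact: AM.
- move=> g [nK Cgp] [_ nCgq]; apply: nK; apply: edge_wall_act.
  by case=> /(_ Cgp).
- by move=> g Kg [].
- by move=> g Kg [].
- move=> a g Aa nKa /nQ Cgq.
  have nCag : ~ C (act (a * g) q).
    by move=> /(init_walls_disjoint Aa nKa); apply; rewrite actM wallK.
  by split=> // /KCq.
- move=> b g Bb nKb /nP nCgp.
  have Cbg : C (act (b * g) p).
    by case: (term_walls_cover Bb nKb (act (b * g) p)) => //; rewrite actM wallK.
  by split=> // /KCp.
Qed.

(** The far end [q] of the edge is the translate by [t] of the near end [p]:
    ping-pong on the vertices beyond the edges [C] and [t^-1 C] at [p]. *)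
Lemma hnn_of_walls t : unseparated q (act t p) -> is_hnn A K t.
Proof.
move=> qtp; pose P : set G := [set g | C (act g p)].
pose Q : set G := [set g | ~ C (act (t * g) p)].
have sAp := is_subgroup_vertex_stab p; have sBq := is_subgroup_vertex_stab q.
have BA b : B b -> A (b ^ t).
  move=> Bb; have ptq : unseparated p (act t^-1 q).
    have := unseparated_act t^-1 qtp; rewrite -actM mulVg act1.
    exact: unseparated_sym.
  rewrite /vertex_stab /= conjgE actM.
  apply: (unseparated_trans ptq); apply: unseparated_act.
  apply: (unseparated_trans Bb); rewrite actM; exact: unseparated_act.
have AB a : A a -> B (a ^ t^-1).
  move=> Aa; rewrite /vertex_stab /= conjgE invgK actM.
  apply: (unseparated_trans qtp); apply: unseparated_act.
  apply: (unseparated_trans Aa); rewrite actM; apply: unseparated_act.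
  have := unseparated_act t^-1 qtp; rewrite -actM mulVg act1.
  exact: unseparated_sym.
have Ct x : unseparated p x -> C (act t x).
  move=> px; rewrite -wall1; apply: (unseparated_act t px 1).1.
  by apply: (qtp 1).1; rewrite wall1.
have CA a : A a -> ~ C (act a p).
  by move=> Aa; rewrite -wall1 => /(Aa 1).2; rewrite wall1.
apply: (@hnn_of_pingpong _ A K P Q t) => //.
- exact: wall_stab_fix_init.
- by move=> k Kk; apply/BA/wall_stab_fix_term.
- move=> M sM AM Mt; have adjM w : unseparated q (act w p) -> M w.
    move=> qwp; rewrite -[w](mulVKg t); apply: subgroupM => //; apply: AM.
    have := unseparated_act t^-1 (unseparated_trans (unseparated_sym qtp) qwp).
    by rewrite -!actM mulVg act1.
  apply: walls_generate => // b c w; case: b c => -[] /=.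
  + move=> /BA/AM; rewrite conjgE => Mw.
    rewrite -[w](mulgK t) -[w * t](mulVKg t); apply: subgroupM => //.
      exact: subgroupM.
    exact: subgroupV.
  + exact: adjM.
  + move=> pwq; rewrite -[w]invgK; apply: subgroupV => //; apply: adjM.
    by have := unseparated_act w^-1 pwq; rewrite -actM mulVg act1 => /unseparated_sym.
  + exact: AM.
- by move=> a Aa; apply; rewrite actM; apply: Ct.
- by move=> g /contrapT.
- by move=> g nPg; rewrite /Q /= mulVKg.
- move=> a g Aa Pg Pag; apply: contrapT => nKa.
  by apply: (init_walls_disjoint Aa nKa Pag); rewrite actM wallK.
- move=> a g Aa Qg Qag; apply: contrapT => nKa.
  have [] := term_walls_cover (AB _ Aa) nKa (act (t * (a * g)) p) => //.
  by rewrite /wall /= -actM conjgE; grp.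
- move=> a g Aa Pg; apply; set w := t * a.
  have qwp : unseparated q (act w p).
    apply: (unseparated_trans qtp); rewrite actM; exact: unseparated_act.
  have nwq : ~ wall w q by move=> /(qwp w).1; rewrite wallK.
  have nKw : ~ K w by move=> Kw; apply: nwq; rewrite Kw.
  have nwp : ~ wall w p.
    by move=> wp; apply: nKw; apply: edge_wall => -[/(_ wp)].
  have Cwp : C (act w p) by rewrite -wall1; apply: (qwp 1).1; rewrite wall1.
  rewrite mulgA -/w actM; case: (wall_nested w) => H.
  + by apply: H; rewrite wallK.
  + by case: nwq; apply: H.
  + case: nKw; apply: edge_wall_act => -[/(_ Cwp) Cwq _].
    by apply: (H _ Cwq); rewrite wallK.
  + by case: (H p).
Qed.

(** If one vertex group were equal to the edge group, the other would be all of
    [G] and would fix its vertex; this is what the two hypotheses exclude. *)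
Lemma splits_over_wall_stab :
  (exists g, ~ A g) -> (exists g, ~ B g) -> splits_over K.
Proof.
move=> [a nAa] [b nBb].
have [[t qtp]|noadj] := pselect (exists t, unseparated q (act t p)).
  by exists (Hnn A K t); split=> //; apply: hnn_of_walls.
exists (Amalgam A B K); split=> //.
have amalg : is_amalgam A B K.
  by apply: amalgam_of_walls => t qtp; apply: noadj; exists t.
have gen M : is_subgroup M -> A `<=` M -> B `<=` M -> forall g, M g.
  move=> sM AM BM; apply: walls_generate => // e c w; case: e c => -[] /=.
  - exact: BM.
  - by move=> qwp; case: noadj; exists w.
  - move=> pwq; case: noadj; exists w^-1; apply: unseparated_sym.
    by have := unseparated_act w^-1 pwq; rewrite -actM mulVg act1.
  - exact: AM.
split=> // [AK|KB].
- apply: nBb; apply: (gen B) => //; first exact: is_subgroup_vertex_stab.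
  by rewrite AK; apply: wall_stab_fix_term.
- apply: nAa; apply: (gen A) => //; first exact: is_subgroup_vertex_stab.
  by rewrite -KB; apply: wall_stab_fix_init.
Qed.

End Walls.

(** * Splittings from nested directions *)

(** The vertex of a point [g] of [G] is the coset [g S], and [C] is a
    direction at the base vertex.  The translates [ltrans g C] are directions at
    [g S].  The hypotheses say how the directions at two vertices are nested,
    according to whether each vertex lies in the direction seen from the other. *)
Section Directions.
Variable G : groupType.
Variables C S : set G.
Hypothesis sS : is_subgroup S.
Hypothesis CS : forall g s, C g -> S s -> C (g * s).
Hypothesis nSC : forall g, C g -> ~ S g.
Hypothesis same_owner : forall g, S g ->
  ltrans g C = C \/ (forall x, C x -> ~ ltrans g C x).
Hypothesis facing : forall g, C g -> C g^-1 -> forall x, C x \/ ltrans g C x.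
Hypothesis following : forall g, ~ S g -> C g -> ~ C g^-1 -> ltrans g C `<=` C.
Hypothesis back_to_back : forall g, ~ S g -> ~ C g -> ~ C g^-1 ->
  forall x, C x -> ~ ltrans g C x.
Hypothesis finite_directions : forall x y, exists l : seq G,
  forall g, ltrans g C x -> ~ ltrans g C y ->
    exists2 g', g' \in l & ltrans g C = ltrans g' C.
Variable a : G.
Hypothesis Ca : C a.
Hypothesis nCaV : ~ C a^-1.

Definition direction_stab : set G := [set g | ltrans g C = C].
Local Notation K := direction_stab.

Lemma direction_stabE g h : K (g^-1 * h) <-> ltrans h C = ltrans g C.
Proof.
rewrite /direction_stab /= -ltransM; split=> [H|->].
  by rewrite -[in RHS]H !ltransM; grp.
by rewrite ltransVK.
Qed.

Lemma is_subgroup_direction_stab : is_subgroup K.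
Proof.
apply/is_subgroupP; split=> [|x y Kx Ky]; first exact: ltrans1.
by rewrite /direction_stab /= -ltransM -[in LHS]Ky ltransVK.
Qed.
Let sK := is_subgroup_direction_stab.

Lemma base_not_in_direction : ~ C 1.
Proof. by move=> C1; apply: (nSC C1); apply: subgroup1. Qed.

Lemma direction_stab_not_in k : K k -> ~ C k.
Proof.
move=> Kk; rewrite -Kk => /ltransE; rewrite mulVg.
exact: base_not_in_direction.
Qed.

(** A direction is seen from one vertex only. *)
Lemma direction_stab_sub : K `<=` S.
Proof.
move=> k Kk; apply: contrapT => nSk.
have nCk := direction_stab_not_in Kk.
have nCkV := direction_stab_not_in (subgroupV sK Kk).
by apply: (back_to_back nSk nCk nCkV Ca); rewrite Kk.
Qed.

Definition vertex_act (g : G) (v : bool * G) : bool * G := (v.1, g * v.2).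

(** The points with first component [true] are the far ends of the edges.  Without
    them, two opposite directions [ltrans g C] and [C] whose vertices face each
    other might be complementary, so that [g] inverts an edge; the far end
    common to both edges lies in both walls and keeps the edges apart. *)
Definition direction_wall : set (bool * G) :=
  [set v : bool * G | C v.2 \/ v.1 /\ K v.2].

Lemma wall_directionE g v : wall vertex_act direction_wall g v <->
  ltrans g C v.2 \/ v.1 /\ ltrans v.2 C = ltrans g C.
Proof. by rewrite -direction_stabE ltransE. Qed.

Lemma wall_stab_direction : wall_stab vertex_act direction_wall = K.
Proof.
apply/seteqP; split=> g; rewrite /wall_stab /=.
  move=> gC; apply/seteqP; split=> x.
    have := wall_directionE g (false, x); rewrite gC => -[_ H] gCx.
    by have [|[]] := H (or_introl gCx).
  have := wall_directionE g (false, x); rewrite gC => -[H _] Cx.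
  by have [|[]] := H (or_introl Cx).
move=> Kg; apply/seteqP; split=> v; rewrite wall_directionE Kg.
  by case; [left|right].
by case; [left|right].
Qed.

Lemma splits_over_direction_stab : splits_over K.
Proof.
have C1 := base_not_in_direction; have K1 := subgroup1 sK.
have SK g : K g -> S g by apply: direction_stab_sub.
rewrite -wall_stab_direction.
apply: (@splits_over_wall_stab _ _ vertex_act direction_wall (false, 1) (true, 1)).
- by case=> b x; rewrite /vertex_act /= mul1g.
- by move=> g h [b x]; rewrite /vertex_act /= mulgA.
- move=> g; have wE v : wall vertex_act direction_wall g v <->
      ltrans g C v.2 \/ v.1 /\ K (g^-1 * v.2).
    by rewrite wall_directionE direction_stabE.
  have [Sg|nSg] := pselect (S g).
    have [Kg|disj] := same_owner Sg.
      have : K g by []; rewrite -wall_stab_direction /wall_stab /= => ->.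
      exact: Or41.
    apply: Or43 => -[b h] Hv /wE Hw; move: Hv Hw; rewrite /direction_wall /=.
    move=> [Ch|[_ Kh]] [gCh|[_ Kgh]].
    + exact: disj gCh.
    + by apply: (nSC Ch); rewrite -[h](mulVKg g); apply: subgroupM => //; apply: SK.
    + move/ltransE: gCh => /nSC; apply; apply: subgroupM => //; last exact: SK.
      exact: subgroupV.
    + apply: (disj a Ca); suff -> : ltrans g C = C by [].
      have : K g by rewrite -[g](mulgK (g^-1 * h)) mulVKg; apply: subgroupM => //; apply: subgroupV.
      by [].
  have CSI h s : S s -> C (h * s) -> C h.
    by move=> Ss Chs; rewrite -[h](mulgK s); apply: CS => //; apply: subgroupV.
  have [Cg|nCg] := pselect (C g); have [CgV|nCgV] := pselect (C g^-1).
  + apply: Or44 => v; rewrite wE /direction_wall /=.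
    by case: (facing Cg CgV v.2) => ?; [left; left|right; left].
  + apply: Or41 => v; rewrite wE /direction_wall /= => -[gv|[_ Kgv]]; left.
      exact: following gv.
    by rewrite -[v.2](mulVKg g); apply: CS => //; apply: SK.
  + apply: Or42 => v; rewrite wE /direction_wall /= => -[Cv|[_ Kv]]; left.
      apply/ltransE; apply: (@following g^-1) => //; rewrite ?invgK //.
        by move=> SgV; apply: nSg; rewrite -[g]invgK; apply: subgroupV.
      by apply/ltransE; rewrite invgK mulVKg.
    by apply/ltransE; apply: CS => //; apply: SK.
  + apply: Or43 => -[b h] Hv /wE Hw; move: Hv Hw; rewrite /direction_wall /=.
    move=> [Ch|[_ Kh]] [gCh|[_ Kgh]].
    * exact: back_to_back gCh.
    * by apply/nCg/(CSI _ _ (SK _ Kgh)); rewrite mulVKg.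
    * by move/ltransE: gCh => /(CSI _ _ (SK _ Kh)).
    * apply: nSg; rewrite -[g](mulgK (g^-1 * h)) mulVKg.
      exact: subgroupM sS (SK _ Kh) (subgroupV sS (SK _ Kgh)).
- by case=> // -[].
- by right.
- move=> g; rewrite wall_stab_direction => sep; apply: contrapT => nKg.
  apply: sep; rewrite !wall_directionE /=; split=> [[H|[//]]|[H|[_ e]]]; try by left.
  by case: nKg; rewrite /direction_stab /= -e ltrans1.
- move=> [b x] [c y].
  have [l Hl] := finite_directions x y; have [l' Hl'] := finite_directions y x.
  exists (x :: y :: l ++ l') => g; rewrite /separates !wall_directionE /= => sep.
  suff [g' g'l gg'] : exists2 g', g' \in x :: y :: l ++ l' & ltrans g C = ltrans g' C.
    exists g' => //; apply/seteqP.
    by split=> v; rewrite !wall_directionE gg'.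
  have [ex|nx] := pselect (ltrans x C = ltrans g C).
    by exists x => //; rewrite inE eqxx.
  have [ey|ny] := pselect (ltrans y C = ltrans g C).
    by exists y => //; rewrite !inE eqxx orbT.
  have [gx|ngx] := pselect (ltrans g C x).
    have ngy : ~ ltrans g C y by move=> gy; apply: sep; split=> _; left.
    have [g' g'l gg'] := Hl _ gx ngy; exists g' => //.
    by rewrite !inE mem_cat g'l !orbT.
  have gy : ltrans g C y.
    by apply: contrapT => ngy; apply: sep; split=> -[|[]].
  have [g' g'l gg'] := Hl' _ gy ngx; exists g' => //.
  by rewrite !inE mem_cat g'l !orbT.
- exists a => /(_ 1) []; rewrite !wall_directionE /= => _.
  rewrite mulg1 ltrans1 => H; have [|[]] // := H (or_introl Ca).
- exists a => /(_ a); rewrite !wall_directionE /= mulg1 => -[_ H].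
  have [|/ltransE|[_ e]] // := H; first by right.
    by rewrite mulg1.
  apply: (nSC Ca); apply: SK; rewrite /direction_stab /= -e; exact: ltrans1.
Qed.

End Directions.

(** * Boundaries in the Cayley graph *)

Section CayleyGraph.
Variable G : groupType.
Variable s : seq G.
Hypothesis gen_s : generated [set` s] = [set: G].
Implicit Types (U V Q : set G) (x y g b c : G).

(** The letter [1] makes the balls increasing. *)
Definition letters : seq G := 1 :: s ++ map (@inv G) s.

Fixpoint ball n : seq G :=
  if n is m.+1 then [seq b * c | b <- ball m, c <- letters] else [:: 1].

Lemma ballSP n x :
  reflect (exists b c, [/\ b \in ball n, c \in letters & x = b * c])
          (x \in ball n.+1).
Proof.
apply: (iffP allpairsP) => [[[b c] [? ? ->]]|[b [c [? ? ->]]]].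
  by exists b, c.
by exists (b, c).
Qed.

Lemma letter1 : 1 \in letters. Proof. by rewrite inE eqxx. Qed.

Lemma letterV c : c \in letters -> c^-1 \in letters.
Proof.
rewrite !inE !mem_cat => /orP[/eqP->|/orP[cs|/mapP[d ds ->]]].
- by rewrite invg1 eqxx.
- by rewrite (map_f (@inv G) cs) !orbT.
- by rewrite invgK ds orbT.
Qed.

Lemma ball_mul m n x y : x \in ball m -> y \in ball n -> x * y \in ball (m + n).
Proof.
move=> xm; elim: n y => [|n IH] y.
  by rewrite inE => /eqP->; rewrite addn0 mulg1.
move=> /ballSP[b [c [bn cl ->]]]; rewrite addnS mulgA; apply/ballSP.
by exists (x * b), c; split=> //; apply: IH.
Qed.

Lemma ball_letter c : c \in letters -> c \in ball 1%N.
Proof.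
by move=> cl; apply/ballSP; exists 1, c; rewrite mul1g inE eqxx.
Qed.

Lemma ball_leq m n x : (m <= n)%N -> x \in ball m -> x \in ball n.
Proof.
move=> /subnKC <- xm; rewrite -[x]mulg1; apply: ball_mul => //.
elim: (n - m)%N => [|k IH]; first by rewrite inE.
by apply/ballSP; exists 1, 1; rewrite mulg1 letter1.
Qed.

Lemma ball_inv n x : x \in ball n -> x^-1 \in ball n.
Proof.
elim: n x => [|n IH] x; first by rewrite !inE => /eqP->; rewrite invg1.
move=> /ballSP[b [c [/IH bn /letterV/ball_letter c1 ->]]].
by rewrite invgM -add1n; apply: ball_mul.
Qed.

Lemma in_some_ball x : exists n, x \in ball n.
Proof.
suff : [set y | exists n, y \in ball n] x by [].
have : generated [set` s] x by rewrite gen_s.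
apply: generated_min => [|y /= ys].
  apply/is_subgroupP; split=> [|y z [m ym] [n zn]]; first by exists 0%N; rewrite inE.
  by exists (m + n); apply: ball_mul => //; apply: ball_inv.
by exists 1%N; apply: ball_letter; rewrite inE mem_cat ys orbT.
Qed.

Lemma seq_in_some_ball (l : seq G) : exists n, {subset l <= ball n}.
Proof.
elim: l => [|x l [n ln]]; first by exists 0%N.
have [m xm] := in_some_ball x; exists (m + n) => y.
rewrite inE => /orP[/eqP->|/ln yn]; first by apply: ball_leq xm; rewrite leq_addr.
by apply: ball_leq yn; rewrite leq_addl.
Qed.

Definition boundary U : set G :=
  [set x | exists2 c, c \in letters & ~ (U x <-> U (x * c))].

Definition near n U x : Prop := exists2 b, b \in ball n & boundary U (x * b).

(** For a set [U] almost invariant over a subgroup [H], this is [H]-finiteness,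
    but it is expressed by [U] alone, hence is manifestly equivariant. *)
Definition small U Q : Prop := exists n, forall x, Q x -> near n U x.

Lemma boundaryC U : boundary (~` U) = boundary U.
Proof.
apply/seteqP; split=> x [c cl ne]; exists c => //;
  have := pselect (U x); have := pselect (U (x * c));
  move: ne; rewrite /setC /=; tauto.
Qed.

Lemma boundary_ltrans g U : boundary (ltrans g U) = ltrans g (boundary U).
Proof.
apply/seteqP; split=> x; rewrite ltransE => -[c cl]; rewrite ?ltransE.
  by rewrite mulgA => ne; exists c.
by rewrite -mulgA => ne; exists c => //; rewrite !ltransE.
Qed.

Lemma nearC n U : near n (~` U) = near n U.
Proof. by rewrite /near boundaryC. Qed.

Lemma smallC U : small (~` U) = small U.
Proof. by apply/funext=> Q; rewrite /small /near boundaryC. Qed.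

Lemma near_ltrans n g U x : near n (ltrans g U) x <-> near n U (g^-1 * x).
Proof.
rewrite /near boundary_ltrans.
by split=> -[b bn]; rewrite ?ltransE => Ub; exists b => //; move: Ub;
  rewrite ?ltransE mulgA.
Qed.

Lemma small_ltrans g U Q : small (ltrans g U) (ltrans g Q) <-> small U Q.
Proof.
split=> -[n H]; exists n => x Qx.
  by have := H (g * x); rewrite ltransE near_ltrans mulKg; apply.
by apply/near_ltrans/H/ltransE.
Qed.

Lemma near_shift m n U x b : b \in ball m -> near n U (x * b) -> near (m + n) U x.
Proof.
move=> bm [b' b'n Ub]; exists (b * b'); first exact: ball_mul.
by rewrite mulgA.
Qed.

Lemma near_leq m n U x : (m <= n)%N -> near m U x -> near n U x.
Proof. by move=> mn [b bm Ub]; exists b => //; apply: ball_leq bm. Qed.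

Lemma small_sub U Q Q' : Q `<=` Q' -> small U Q' -> small U Q.
Proof. by move=> QQ' [n H]; exists n => x /QQ'/H. Qed.

Lemma small_setU U Q Q' : small U Q -> small U Q' -> small U (Q `|` Q').
Proof.
move=> [m Hm] [n Hn]; exists (m + n) => x [/Hm|/Hn]; apply: near_leq.
  exact: leq_addr.
exact: leq_addl.
Qed.

(** A path that starts far from the boundary of [U] does not reach it. *)
Lemma far_const n U x b : ~ near n U x -> b \in ball n -> U x <-> U (x * b).
Proof.
move=> nU; suff H m : (m <= n)%N -> forall b, b \in ball m -> U x <-> U (x * b).
  exact: H.
elim: m => [|m IH] mn {}b; first by rewrite inE => /eqP->; rewrite mulg1.
move=> /ballSP[d [c [dm cl ->]]]; rewrite (IH _ d dm); last exact: ltnW.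
apply: contrapT => ne; apply: nU; exists d.
  by apply: ball_leq dm; apply: ltnW.
by exists c => //; rewrite -mulgA.
Qed.

Lemma boundary_ex U x y : U x -> ~ U y -> exists z, boundary U z.
Proof.
move=> Ux nUy; have [n xyn] := in_some_ball (x^-1 * y).
have [[b _ Ub]|far] := pselect (near n U x); first by exists (x * b).
by case: nUy; move: Ux; rewrite (far_const far xyn) mulVKg.
Qed.

End CayleyGraph.

(** * Almost inclusion between translates of an almost invariant set *)

Section Sides.
Variable G : groupType.
Implicit Types (U : set G) (b : bool).

Definition side b U : set G := if b then U else ~` U.

Lemma sideC b U : ~` side b U = side (~~ b) U.
Proof. by case: b; rewrite /= ?setCK. Qed.

Lemma ltrans_side g b U : ltrans g (side b U) = side b (ltrans g U).
Proof. by case: b; rewrite /= ?ltransC. Qed.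

Lemma side_contra b U x : side b U x -> side (~~ b) U x -> False.
Proof. by case: b => /= ? ?. Qed.

Lemma boundary_side s b U : boundary s (side b U) = boundary s U.
Proof. by case: b; rewrite /= ?boundaryC. Qed.

Lemma small_side s b U : small s (side b U) = small s U.
Proof. by rewrite /small /near boundary_side. Qed.

Lemma translatesP X U :
  translates X U <-> exists g b, U = side b (ltrans g X).
Proof.
split=> [[g [->|->]]|[g [b ->]]]; exists g.
- by exists true.
- by exists false; rewrite ltransC.
- by case: b; [left|right; rewrite ltransC].
Qed.

Lemma translatesC X U : translates X U -> translates X (~` U).
Proof.
by move=> /translatesP[g [b ->]]; apply/translatesP; exists g, (~~ b); rewrite sideC.
Qed.

Lemma translates_ltrans X U h : translates X U -> translates X (ltrans h U).
Proof.
move=> /translatesP[g [b ->]]; apply/translatesP; exists (h * g), b.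
by rewrite ltrans_side ltransM.
Qed.

Lemma translates_self X b : translates X (side b X).
Proof. by apply/translatesP; exists 1, b; rewrite ltrans1. Qed.

End Sides.

Section AlmostInvariantSets.
Variable G : groupType.
Variable s : seq G.
Hypothesis gen_s : generated [set` s] = [set: G].
Variables H X : set G.
Hypothesis sH : is_subgroup H.
Hypothesis aiX : almost_invariant H X.
Hypothesis ntX : nontrivial_over H X.
Implicit Types (A B U V W Q : set G).

Local Notation E := (translates X).
Local Notation boundary := (boundary s).
Local Notation near := (near s).
Local Notation small := (small s).
Local Notation ball := (ball s).
Local Notation letters := (letters s).

Lemma stab_ai h : H h -> ltrans h X = X.
Proof. exact: aiX.1. Qed.

Lemma boundary_stab h x : H h -> boundary X (h * x) <-> boundary X x.
Proof.
move=> Hh; rewrite -{2}(stab_ai (subgroupV sH Hh)).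
by rewrite boundary_ltrans ltransE invgK.
Qed.

Lemma boundary_nonempty : exists x, boundary X x.
Proof.
case: ntX => nX nXC.
have [x Xx] : exists x, X x.
  apply: contrapT => none; apply: nX; exists [::] => x Xx.
  by case: none; exists x.
have [y nXy] : exists y, ~ X y.
  apply: contrapT => none; apply: nXC; exists [::] => y nXy.
  by case: none; exists y.
exact: boundary_ex gen_s _ _ _ Xx nXy.
Qed.

(** The boundary is contained in the union of the symmetric differences of [X]
    with its right translates by the finitely many letters. *)
Lemma boundary_cofinite : exists l : seq G, forall x, boundary X x ->
  exists h f, [/\ H h, f \in l & x = h * f].
Proof.
have cov (cs : seq G) : exists l : seq G, forall x c, c \in cs -> ~ (X x <-> X (x * c)) ->
    exists h f, [/\ H h, f \in l & x = h * f].
  elim: cs => [|d cs [l Hl]]; first by exists [::].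
  have [l' Hl'] := aiX.2 d^-1; exists (l' ++ l) => x c.
  rewrite inE => /orP[/eqP->|cs_c] ne.
    have /Hl'[f fl' /rtransE Hxf] : (X `+` rtrans X d^-1) x.
      have e := rtransE d^-1 X x; rewrite invgK in e.
      have := pselect (X x); have := pselect (X (x * d)); move: ne.
      by rewrite /setY /=; tauto.
    exists (x * f^-1), f; split=> //; last by rewrite mulgVK.
    by rewrite mem_cat; apply/orP; left.
  have [h [f [Hh fl ->]]] := Hl x c cs_c ne; exists h, f; split=> //.
  by rewrite mem_cat fl orbT.
have [l Hl] := cov letters; exists l => x [c cl ne]; exact: Hl ne.
Qed.

(** The boundary of [X] is nonempty, stable under [H], and covered by finitely
    many cosets of [H], so being covered by finitely many cosets and being within
    bounded distance of the boundary amount to the same. *)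
Lemma finite_over_small g Q : finite_over (conj_sub g H) Q <-> small (ltrans g X) Q.
Proof.
split=> [[l Hl]|[n Hn]].
  have [x0 bx0] := boundary_nonempty.
  have [n ln] := seq_in_some_ball gen_s [seq f^-1 * g * x0 | f <- l].
  exists n => x /Hl[f /= fl /rtransE[h Hh xf]].
  exists (f^-1 * g * x0); first exact/ln/map_f.
  rewrite boundary_ltrans ltransE.
  have -> : x = g * h * g^-1 * f by rewrite xf mulgVK.
  rewrite (_ : g^-1 * _ = h * x0); last by grp.
  exact/boundary_stab.
have [l Hl] := boundary_cofinite.
exists [seq g * f * b^-1 | f <- l, b <- ball n] => x /Hn[b bn].
rewrite boundary_ltrans ltransE => /Hl[h [f [Hh fl e]]].
exists (g * f * b^-1); first by apply/allpairsP; exists (f, b).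
apply/rtransE; exists h => //.
have -> : x = g * (h * f) * b^-1 by rewrite -e; grp.
by grp.
Qed.

Lemma translate_not_small U : E U -> ~ small U U.
Proof.
move=> /translatesP[g [b ->]]; rewrite small_side -ltrans_side small_ltrans.
rewrite -[Y in small Y _]ltrans1 -finite_over_small.
have -> : conj_sub 1 H = H.
  apply/seteqP; split=> x; first by move=> [h Hh <-]; grp.
  by move=> Hx; exists x => //; grp.
by case: b; case: ntX.
Qed.

Lemma deep_point U n : E U -> exists x, U x /\ ~ near n U x.
Proof.
move=> /translate_not_small nsm; apply: contrapT => none; apply: nsm.
by exists n => x Ux; apply: contrapT => nn; apply: none; exists x.
Qed.

(** A translate [V] has points arbitrarily far from its boundary.  As the
    stabiliser acts on the boundary with finitely many orbits, they are found
    within a uniform distance of each boundary point. *)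
Lemma deep_uniform V n : E V -> exists m, forall x, boundary V x ->
  exists b, [/\ b \in ball m, V (x * b) & ~ near n V (x * b)].
Proof.
move=> EV; have [g [b eV]] := (translatesP X V).1 EV.
have [l Hl] := boundary_cofinite.
have [y [Vy ny]] := deep_point n (translates_self X b).
have [m lm] := seq_in_some_ball gen_s [seq f^-1 * y | f <- l].
exists m => x; rewrite eV boundary_side boundary_ltrans ltransE.
move=> /Hl[h [f [Hh fl e]]]; exists (f^-1 * y).
have {e}-> : x = g * h * f by rewrite -mulgA -e; grp.
have -> : g * h * f * (f^-1 * y) = (g * h) * y by grp.
have -> : ltrans g X = ltrans (g * h) X by rewrite -ltransM (stab_ai Hh).
rewrite -ltrans_side; split; first exact/lm/map_f.
  by apply/ltransE; rewrite mulKg.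
by move/near_ltrans; rewrite mulKg.
Qed.

(** A point [x] of [Q] is near the boundary of [V], so it has a point [y] nearby
    that is outside [V] and far from the boundary of [V].  If [x] were far inside
    [U], then [y] would be in [U] and outside [V], yet such points are near the
    boundary of [V]. *)
Lemma small_transfer U V Q : E V -> small V (U `&` ~` V) -> small V Q ->
  small U (U `&` Q).
Proof.
move=> EV [e He] [d Hd].
have [m Hm] := deep_uniform e (translatesC EV).
exists (d + m) => x [Ux Qx]; apply: contrapT => farU.
have [b bd bVx] := Hd x Qx; rewrite -boundaryC in bVx.
have [b' [b'm nVy]] := Hm _ bVx.
rewrite nearC -mulgA; apply; apply: He; split; last by rewrite mulgA.
by apply/(far_const farU) => //; apply: ball_mul.
Qed.

Definition almost_sub U V : Prop := small U (U `&` ~` V).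

(** Smallness of the difference does not depend on which of the two sets it is
    measured by. *)
Lemma almost_sub_small U V : E U -> E V ->
  almost_sub U V <-> small V (U `&` ~` V).
Proof.
move=> EU EV; split=> sm; last first.
  by apply: small_sub (small_transfer EV sm sm) => x [].
have sm' : small (~` U) (~` V `&` ~` ~` U) by rewrite smallC setCK setIC.
rewrite -smallC; apply: small_sub (small_transfer (translatesC EU) sm' sm').
by move=> x [Ux nVx]; split=> //; split=> // -[].
Qed.

Lemma almost_subC U V : E U -> E V -> almost_sub U V -> almost_sub (~` V) (~` U).
Proof.
by move=> EU EV /(almost_sub_small EU EV); rewrite /almost_sub smallC setCK setIC.
Qed.

Lemma almost_sub_refl U : almost_sub U U.
Proof. by exists 0%N => x []. Qed.

Lemma almost_sub_trans V U W : E U -> E V -> E W ->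
  almost_sub U V -> almost_sub V W -> almost_sub U W.
Proof.
move=> EU EV EW /(almost_sub_small EU EV) UV VW.
have sm : small V (U `&` ~` W).
  apply: small_sub (small_setU UV VW) => x [Ux nWx].
  by have [Vx|nVx] := pselect (V x); [right|left].
by apply: small_sub (small_transfer EV UV sm) => x [].
Qed.

Lemma almost_sub_consistent U V : E U -> almost_sub U V -> ~ almost_sub U (~` V).
Proof.
move=> EU UV UV'; apply: (translate_not_small EU).
apply: small_sub (small_setU UV UV') => x Ux.
by have [Vx|nVx] := pselect (V x); [right; split=> // -[]|left].
Qed.

Lemma almost_sub_ltrans g U V :
  almost_sub (ltrans g U) (ltrans g V) <-> almost_sub U V.
Proof.
rewrite /almost_sub -ltransC (_ : _ `&` _ = ltrans g (U `&` ~` V)).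
  exact: small_ltrans.
apply/seteqP; split=> x; first by move=> [/ltransE ? /ltransE ?]; apply/ltransE.
by move=> /ltransE[? ?]; split; apply/ltransE.
Qed.

Lemma almost_sub_empty U V : ~ almost_sub U V -> exists x, U x /\ ~ V x.
Proof.
move=> nUV; apply: contrapT => none; apply: nUV; exists 0%N => x [Ux nVx].
by case: none; exists x.
Qed.

Section FinitelyGeneratedStabiliser.
Variable r : seq G.
Hypothesis gen_r : H = generated [set` r].

(** As [H] is finitely generated, a neighbourhood [D] of [H] of sufficiently
    large radius is connected and contains the boundary of [X].  If the boundary of
    [X] misses [g D] and that of [g X] misses [D], then [D] is on one side
    of [g X] and [g D] on one side of [X], and the opposite corner has no boundary,
    hence is empty.  So four nonempty corners force one of these boundaries to
    meet the neighbourhood of the other, which pins down [g X] up to [H]. *)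
Lemma four_corners_orbits : exists l : seq G, forall g,
    (forall b c, exists x, side b X x /\ side c (ltrans g X) x) ->
  exists h f, [/\ H h, f \in l & ltrans g X = ltrans h (ltrans f X)].
Proof.
have [l0 Hl0] := boundary_cofinite.
have [n ln] := seq_in_some_ball gen_s (l0 ++ r).
pose D : set G := [set x | exists h b, [/\ H h, b \in ball n & x = h * b]].
have bXD x : boundary X x -> D x.
  move=> /Hl0[h [f [Hh fl ->]]]; exists h, f; split=> //.
  by apply: ln; rewrite mem_cat fl.
have one_ball : 1 \in ball n by apply: (@ball_leq _ _ 0%N); rewrite ?inE.
have D1 : D 1 by exists 1, 1; rewrite mulg1; split=> //; apply: subgroup1.
have Dconst V : (forall x, boundary V x -> ~ D x) -> forall x, D x -> V x <-> V 1.
  move=> bVD.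
  have far h : H h -> ~ near n V h.
    by move=> Hh [b bn /bVD]; apply; exists h, b.
  (* [V] is constant on [H] because the ball around each [h] contains the
   neighbours [h * k] for the generators [k] of [H]. *)
  have HV : H `<=` [set k | H k /\ forall h, H h -> V (h * k) <-> V h].
    rewrite {1}gen_r; apply: generated_min => [|k /= kr].
      apply/is_subgroupP; split=> [|x y [Hx xV] [Hy yV]].
        by split=> [|h _]; rewrite ?mulg1 //; apply: subgroup1.
      have HyV := subgroupV sH Hy; split; first exact: subgroupM.
      move=> h Hh; rewrite mulgA -(xV h Hh) -[X in _ <-> V X](mulgVK y).
      by rewrite yV //; apply: subgroupM => //; apply: subgroupM.
    split; first by rewrite gen_r => M [_]; apply.
    move=> h Hh; rewrite -(far_const (far h Hh)) //.
    by apply: ln; rewrite mem_cat kr orbT.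
  move=> x [h [b [Hh bn ->]]]; rewrite -(far_const (far h Hh) bn).
  by have [_ /(_ 1 (subgroup1 sH))] := HV h Hh; rewrite mul1g.
exists ([seq b * f^-1 | b <- ball n, f <- l0] ++ [seq f * b^-1 | f <- l0, b <- ball n]).
move=> g corners.
have [[x [bgx [h [b [Hh bn xhb]]]]]|far1] :=
    pselect (exists x, boundary (ltrans g X) x /\ D x).
  have [h' [f [Hh' fl e]]] : exists h f, [/\ H h, f \in l0 & g^-1 * x = h * f].
    by apply: Hl0; move: bgx; rewrite boundary_ltrans ltransE.
  exists h, (b * f^-1); split=> //.
    by rewrite mem_cat; apply/orP; left; apply/allpairsP; exists (b, f).
  rewrite -[X in RHS](stab_ai (subgroupV sH Hh')) !ltransM; congr ltrans.
  have -> : g = x * (g^-1 * x)^-1 by grp.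
  by rewrite e xhb; grp.
have [[x [bx [h [b [Hh bn xhb]]]]]|far2] :=
    pselect (exists x, boundary X x /\ D (g^-1 * x)).
  have [h' [f [Hh' fl e]]] := Hl0 _ bx.
  exists h', (f * b^-1); split=> //.
    by rewrite mem_cat; apply/orP; right; apply/allpairsP; exists (f, b).
  rewrite -[X in RHS](stab_ai (subgroupV sH Hh)) !ltransM; congr ltrans.
  have -> : g = x * (g^-1 * x)^-1 by grp.
  by rewrite xhb e; grp.
have choose_side U : exists b, side b U 1.
  by have [U1|nU1] := pselect (U 1); [exists true|exists false].
have DgX : exists c, forall x, D x -> side c (ltrans g X) x.
  have [c gX1] := choose_side (ltrans g X); exists c => x Dx.
  apply/(Dconst (side c (ltrans g X))) => // z; rewrite boundary_side => bz Dz.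
  by apply: far1; exists z.
have gDX : exists b, forall x, D (g^-1 * x) -> side b X x.
  have [b X1] := choose_side (ltrans g^-1 X); exists b => x Dx.
  have : side b (ltrans g^-1 X) (g^-1 * x).
    apply/(Dconst (side b (ltrans g^-1 X))) => // z.
    rewrite boundary_side boundary_ltrans ltransE invgK => bz Dz.
    by apply: far2; exists (g * z); rewrite mulKg.
  by rewrite -ltrans_side ltransE invgK mulVKg.
have [c DgXc] := DgX; have [b gDXb] := gDX.
pose Q : set G := side (~~ b) X `&` side (~~ c) (ltrans g X).
have [x Qx] : exists x, Q x by apply: corners.
have nQ1 : ~ Q 1 by move=> [_]; apply: side_contra; apply: DgXc.
(* The corner [Q] opposite to the sides containing [D] and [g D] has no boundary. *)
have stuck w d : d \in letters -> Q w -> ~ Q (w * d) -> False.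
  move=> dl [Xw gXw] nQwd.
  have [Xwd|nXwd] := pselect (side (~~ b) X (w * d)).
    have bw : boundary (ltrans g X) w.
      rewrite -(boundary_side _ (~~ c)); exists d => // -[/(_ gXw) gXwd _].
      by apply: nQwd.
    apply: (side_contra _ Xw); apply: gDXb; apply: bXD.
    by move: bw; rewrite boundary_ltrans ltransE.
  have bw : boundary X w.
    by rewrite -(boundary_side _ (~~ b)); exists d => // -[/(_ Xw)].
  by apply: (side_contra _ gXw); apply: DgXc; apply: bXD.
have [z [d dl ne]] := boundary_ex gen_s Qx nQ1.
have [Qz|nQz] := pselect (Q z).
  by case: (stuck z d dl Qz) => Qzd; apply: ne.
have Qzd : Q (z * d) by apply: contrapT => nQzd; apply: ne.
by case: (stuck _ d^-1 (letterV dl) Qzd); rewrite mulgK.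
Qed.

(** Exactly one of the four corners of [U] and [V] is small. *)
Definition strictly_below U V : Prop :=
  [/\ almost_sub U V, ~ almost_sub U (~` V), ~ almost_sub (~` U) (~` V) &
      ~ almost_sub (~` U) V].

Lemma strictly_belowC U V : E U -> E V ->
  strictly_below U V -> strictly_below (~` V) (~` U).
Proof.
move=> EU EV; have EUC := translatesC EU; have EVC := translatesC EV.
move=> [s1 s2 s3 s4]; split; first exact: almost_subC.
- by rewrite setCK => /(almost_subC EVC EU); rewrite setCK.
- by rewrite !setCK => /(almost_subC EV EU).
- by rewrite setCK => /(almost_subC EV EUC); rewrite setCK.
Qed.

Lemma strictly_below_ltrans g U V :
  strictly_below (ltrans g U) (ltrans g V) <-> strictly_below U V.
Proof.
rewrite /strictly_below -!ltransC.
by split=> -[s1 s2 s3 s4]; split; move: s1 s2 s3 s4; rewrite !almost_sub_ltrans.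
Qed.

Lemma strictly_below_corners U V b c :
  strictly_below U V -> almost_sub U V /\
    ((exists x, U x /\ ~ V x) -> exists x, side b U x /\ side c V x).
Proof.
move=> [s1 s2 s3 s4]; split=> // nUV; case: b c => -[] //=.
- by have [x [Ux VCx]] := almost_sub_empty s2; exists x; split=> //; apply: contrapT.
- by have [x [Ux VCx]] := almost_sub_empty s3; exists x; split=> //; apply: contrapT.
- by have [x [Ux VCx]] := almost_sub_empty s4; exists x.
Qed.

(** If [U] is not contained in [V], all four corners are nonempty, and there are
    finitely many such [V] up to the stabiliser of [U]. *)
Lemma uniform_near U : E U -> exists n, forall V, E V -> strictly_below U V ->
  forall x, U x -> ~ V x -> near n U x.
Proof.
move=> /translatesP[g [a ->]].
suff [n Hn] : exists n, forall V, E V -> strictly_below (side a X) V ->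
    forall x, side a X x -> ~ V x -> near n (side a X) x.
  exists n => V EV; rewrite -ltrans_side -[V](ltransVK g^-1) invgK.
  rewrite strictly_below_ltrans => sb x /ltransE Ux nVx; apply/near_ltrans.
  by apply: Hn sb _ Ux _ => [|Vx]; [exact: translates_ltrans|exact/nVx/ltransE].
have [l Hl] := four_corners_orbits.
set A := side a X.
have HA h : H h -> ltrans h A = A by move=> Hh; rewrite ltrans_side stab_ai.
have bound (fs : seq G) : exists n, forall f c, f \in fs ->
    almost_sub A (side c (ltrans f X)) ->
    forall x, A x -> ~ side c (ltrans f X) x -> near n A x.
  elim: fs => [|f fs [n Hn]]; first by exists 0%N.
  have ex c : exists m, almost_sub A (side c (ltrans f X)) ->
      forall x, A x -> ~ side c (ltrans f X) x -> near m A x.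
    have [[m Hm]|nsub] := pselect (almost_sub A (side c (ltrans f X))).
      by exists m => _ x Ax nx; apply: Hm.
    by exists 0%N.
  have [m1 H1] := ex true; have [m2 H2] := ex false.
  exists (maxn n (maxn m1 m2)) => f' c; rewrite inE => /orP[/eqP->|f'fs] sub x Ax nx.
    case: c sub nx => sub nx.
      by apply: near_leq (H1 sub x Ax nx); rewrite !leq_max leqnn orbT.
    by apply: near_leq (H2 sub x Ax nx); rewrite !leq_max leqnn !orbT.
  by apply: near_leq (Hn f' c f'fs sub x Ax nx); rewrite leq_maxl.
have [n Hn] := bound l; exists n => V /translatesP[g' [c ->]] sb x Ax nVx.
have [|h [f [Hh fl e]]] := Hl g'.
  move=> b d; have [_] := strictly_below_corners (~~ (a (+) b)) (~~ (c (+) d)) sb.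
  move=> /(_ (ex_intro _ x (conj Ax nVx)))[y [Ay Vy]]; exists y; move: Ay Vy.
  rewrite /A; case: (a) (b) (c) (d) => -[] -[] -[] /= ? ?;
    by split=> //; apply: contrapT.
rewrite -(HA h Hh); apply/near_ltrans; apply: (Hn f c) => //.
- apply/(almost_sub_ltrans h); rewrite HA // ltrans_side -e.
  by case: sb.
- by apply/ltransE; rewrite HA.
- by move=> nV; apply: nVx; rewrite e -ltrans_side; apply/ltransE.
Qed.

(** By uniformity, a point [u] deep in [U] and a point [w] deep outside [W] are
    separated by each [V] between [U] and [W].  Then a fixed path from [u] to [w]
    meets the boundary of [V], which happens for finitely many [V]. *)
Lemma between_finite U W : E U -> E W -> exists l : seq G, forall g c,
    strictly_below U (side c (ltrans g X)) ->
    strictly_below (side c (ltrans g X)) W ->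
  exists2 f, f \in l & ltrans g X = ltrans f X.
Proof.
move=> EU EW; have EWC := translatesC EW.
have [m Hm] := uniform_near EU; have [n Hn] := uniform_near EWC.
have [u [Uu farU]] := deep_point m EU.
have [w [Ww farW]] := deep_point n EWC.
have [l Hl] := boundary_cofinite.
have [k uwk] := in_some_ball gen_s (u^-1 * w).
exists [seq u * b * f^-1 | b <- ball k, f <- l] => g c sbU sbW.
have EV : E (side c (ltrans g X)) by apply/translatesP; exists g, c.
have Vu : side c (ltrans g X) u.
  by apply: contrapT => nVu; apply: farU; apply: Hm sbU _ _ nVu.
have nVw : ~ side c (ltrans g X) w.
  move=> Vw; apply: farW; apply: Hn (strictly_belowC EV EW sbW) _ Ww _.
    exact: translatesC.
  exact.
have [b bk bz] : near k (side c (ltrans g X)) u.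
  apply: contrapT => far; apply: nVw.
  by rewrite -[w](mulVKg u); apply/(far_const far).
move: bz; rewrite boundary_side boundary_ltrans ltransE => /Hl[h [f [Hh fl e]]].
exists (u * b * f^-1); first by apply/allpairsP; exists (b, f).
rewrite -[X in LHS](stab_ai Hh) ltransM; congr ltrans.
have -> : u * b = g * (h * f) by rewrite -e mulVKg.
by grp.
Qed.

End FinitelyGeneratedStabiliser.

End AlmostInvariantSets.

(** * Cross-connected components and their directions *)

Section Components.
Variable G : groupType.
Variables H X : set G.
Implicit Types (U V : set G) (P Q : set (set G)).

Definition connected P Q : Prop := clos_refl_sym_trans _ (bar_crosses H X) P Q.
Definition equivalent U V : Prop := connected (bar U) (bar V).

Lemma equivalent_refl U : equivalent U U.
Proof. exact: rst_refl. Qed.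

Lemma equivalent_sym U V : equivalent U V -> equivalent V U.
Proof. exact: rst_sym. Qed.

Lemma equivalent_trans V U W : equivalent U V -> equivalent V W -> equivalent U W.
Proof. exact: rst_trans. Qed.

Lemma barC U : bar (~` U) = bar U.
Proof. by apply/seteqP; split=> V [->|->]; rewrite /bar /= ?setCK; tauto. Qed.

Lemma equivalentCl U V : equivalent (~` U) V = equivalent U V.
Proof. by rewrite /equivalent barC. Qed.

Lemma equivalentCr U V : equivalent U (~` V) = equivalent U V.
Proof. by rewrite /equivalent barC. Qed.

Lemma equivalent_sidel c U V : equivalent (side c U) V = equivalent U V.
Proof. by case: c => //=; exact: equivalentCl. Qed.

Lemma equivalent_sider c U V : equivalent U (side c V) = equivalent U V.
Proof. by case: c => //=; exact: equivalentCr. Qed.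

Lemma act_pair_bar g U : act_pair g (bar U) = bar (ltrans g U).
Proof.
apply/seteqP; split=> V; first by move=> [W [->|->] <-]; [left|right; rewrite ltransC].
by move=> [->|->]; [exists U|exists (~` U)]; rewrite ?ltransC //; [left|right].
Qed.

Lemma act_pairK g P : act_pair g (act_pair g^-1 P) = P.
Proof.
apply/seteqP; split=> V.
  by move=> [_ [U PU <-] <-]; rewrite ltransM mulgV ltrans1.
move=> PV; exists (ltrans g^-1 V); first by exists V.
by rewrite ltransM mulgV ltrans1.
Qed.

Lemma finite_over_ltrans g h (Q : set G) :
  finite_over (conj_sub h H) Q <-> finite_over (conj_sub (g * h) H) (ltrans g Q).
Proof.
split=> -[l Hl].
  exists [seq g * f | f <- l] => x /ltransE/Hl[f fl /rtransE[k Hk e]].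
  exists (g * f); first exact/map_f.
  apply/rtransE; exists k => //; rewrite invgM [RHS](_ : _ = g * (g^-1 * x * f^-1) * g^-1); last by grp.
  by rewrite -e; grp.
exists [seq g^-1 * f | f <- l] => x Qx.
have /Hl[f fl /rtransE[k Hk e]] : ltrans g Q (g * x) by apply/ltransE; rewrite mulKg.
exists (g^-1 * f); first exact/map_f.
apply/rtransE; exists k => //.
rewrite [RHS](_ : _ = g^-1 * (g * x * f^-1) * g); last by grp.
by rewrite -e; grp.
Qed.

Lemma crosses_ltrans g h U V :
  crosses (conj_sub h H) U V -> crosses (conj_sub (g * h) H) (ltrans g U) (ltrans g V).
Proof.
have cap (A B : set G) : ltrans g A `&` ltrans g B = ltrans g (A `&` B).
  apply/seteqP; split=> x; first by move=> [/ltransE ? /ltransE ?]; apply/ltransE.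
  by move=> /ltransE[? ?]; split; apply/ltransE.
rewrite /crosses -!ltransC !cap.
by move=> [c1 c2 c3 c4]; split; rewrite -finite_over_ltrans.
Qed.

Lemma connected_act g P Q : connected P Q -> connected (act_pair g P) (act_pair g Q).
Proof.
elim=> {P Q} [P Q [h [U [V [hU EV -> -> cr]]]]|P|P Q _|P Q R _ + _].
- apply: rst_step; exists (g * h), (ltrans g U), (ltrans g V); split.
  + by case: hU => ->; rewrite ltransM; [left|right].
  + exact: translates_ltrans.
  + exact: act_pair_bar.
  + exact: act_pair_bar.
  + exact: crosses_ltrans.
- exact: rst_refl.
- exact: rst_sym.
- exact: rst_trans.
Qed.

Lemma equivalent_ltrans g U V : equivalent U V -> equivalent (ltrans g U) (ltrans g V).
Proof. by rewrite /equivalent -!act_pair_bar; apply: connected_act. Qed.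

Lemma equivalent_ltransI g U V : equivalent (ltrans g U) (ltrans g V) -> equivalent U V.
Proof. by move=> /(equivalent_ltrans g^-1); rewrite !ltransVK. Qed.

Definition ccc_stab : set G := [set g | equivalent X (ltrans g X)].

Lemma is_subgroup_ccc_stab : is_subgroup ccc_stab.
Proof.
apply/is_subgroupP; split=> [|x y Sx Sy].
  by rewrite /ccc_stab /= ltrans1; apply: equivalent_refl.
apply: (equivalent_trans Sx); rewrite -ltransM; apply: equivalent_ltrans.
by have := equivalent_ltrans y^-1 Sy; rewrite ltransVK => /equivalent_sym.
Qed.

(** Crossing is equivariant, so an element that keeps [X] in its component
    permutes the members of that component. *)
Lemma ccc_stab_sub : ccc_stab `<=` stab_ccc H X.
Proof.
have sub g P : ccc_stab g -> ccc H X (bar X) P -> ccc H X (bar X) (act_pair g P).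
  move=> Sg [[U EU <-] XP]; split.
    by exists (ltrans g U); [apply: translates_ltrans|rewrite act_pair_bar].
  apply: rst_trans Sg _; rewrite -act_pair_bar.
  exact: connected_act.
move=> g Sg; apply/seteqP; split=> [_ [P PC <-]|P PC]; first exact: sub.
exists (act_pair g^-1 P); last exact: act_pairK.
by apply: sub PC; apply: subgroupV => //; apply: is_subgroup_ccc_stab.
Qed.

End Components.

Section Pretree.
Variable G : groupType.
Variable s : seq G.
Hypothesis gen_s : generated [set` s] = [set: G].
Variables H X : set G.
Hypothesis sH : is_subgroup H.
Hypothesis aiX : almost_invariant H X.
Hypothesis ntX : nontrivial_over H X.
Variable r : seq G.
Hypothesis gen_r : H = generated [set` r].
Hypothesis crossed : ~ isolated H X.
Implicit Types (U V W P Q R : set G).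

Local Notation E := (translates X).
Local Notation le := (almost_sub s).
Local Notation eqv := (equivalent H X).
Local Notation EC := (@translatesC _ X _).

Definition cross U V : Prop :=
  [/\ ~ le U (~` V), ~ le (~` U) (~` V), ~ le U V & ~ le (~` U) V].

Lemma crossesE g b V :
  crosses (conj_sub g H) (side b (ltrans g X)) V <-> cross (side b (ltrans g X)) V.
Proof.
rewrite /crosses /cross /almost_sub !smallC !small_side !setCK.
by split=> -[c1 c2 c3 c4]; split=> /(finite_over_small gen_s sH aiX ntX g).
Qed.

Lemma cross_equivalent U V : E U -> E V -> cross U V -> eqv U V.
Proof.
move=> /translatesP[g [b ->]] EV /crossesE cr; apply: rst_step.
exists g, (side b (ltrans g X)), V; split=> //.
by case: b {cr}; [left|right; rewrite ltransC].
Qed.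

Lemma bar_crossesE (P Q : set (set G)) : bar_crosses H X P Q ->
  exists U V, [/\ E U, E V, P = bar U, Q = bar V & cross U V].
Proof.
move=> [g [U [V [gU EV -> ->]]]].
have [b ->] : exists b, U = side b (ltrans g X).
  by case: gU => ->; [exists true|exists false; rewrite ltransC].
by move=> /crossesE cr; exists (side b (ltrans g X)), V; split=> //; apply/translatesP; exists g, b.
Qed.

Lemma cross_sym U V : E U -> E V -> cross U V -> cross V U.
Proof.
move=> EU EV [c1 c2 c3 c4].
have C := almost_subC gen_s sH aiX ntX.
by split=> /C; rewrite ?setCK => H'; [apply: c1|apply: c3|apply: c2|apply: c4];
  apply: H'; try exact: EC.
Qed.

Let leC := almost_subC gen_s sH aiX ntX.
Let le_trans := almost_sub_trans gen_s sH aiX ntX.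
Let le_consistent := almost_sub_consistent gen_s sH aiX ntX.

Lemma not_equivalent_nested U V : E U -> E V -> ~ eqv U V ->
  [\/ le U V, le U (~` V), le (~` U) V | le (~` U) (~` V)].
Proof.
move=> EU EV nUV; apply: contrapT => none; apply: nUV.
apply: cross_equivalent => //.
by split=> H'; apply: none; [apply: Or42|apply: Or44|apply: Or41|apply: Or43].
Qed.

(** Translating, every element of the family crosses another one. *)
Lemma translate_crossed : exists2 W, E W & cross X W.
Proof.
apply: contrapT => none; apply: crossed => V EV cr; apply: none; exists V => //.
have := (crossesE 1 true V).1; rewrite /= ltrans1; apply.
suff -> : conj_sub 1 H = H by [].
apply/seteqP; split=> x; first by move=> [h Hh <-]; grp.
by move=> Hx; exists x => //; grp.
Qed.

(** A set almost equal to [U] crosses whatever [U] crosses, and [U] does cross a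
    translate of [X]. *)
Lemma mutual_equivalent U V : E U -> E V -> le U V -> le V U -> eqv U V.
Proof.
move=> EU EV UV VU; have [W EW XW] := translate_crossed.
have [g [b eU]] := (translatesP X U).1 EU.
have EW' : E (ltrans g W) by apply: translates_ltrans.
have UW : cross U (ltrans g W).
  case: XW => c1 c2 c3 c4; rewrite eU -ltrans_side /cross -!ltransC.
  split=> /almost_sub_ltrans; case: (b); rewrite /= ?setCK; by [].
apply: (@equivalent_trans _ _ _ (ltrans g W)); first exact: cross_equivalent.
apply: equivalent_sym; apply: cross_equivalent => //.
have nVU := leC EU EV UV; have nUV := leC EV EU VU.
case: UW => c1 c2 c3 c4.
have EUC := EC EU; have EVC := EC EV; have EWC := EC EW'.
split=> H'; [apply: c1|apply: c2|apply: c3|apply: c4].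
- exact: (le_trans EU EV EWC UV H').
- exact: (le_trans EUC EVC EWC nUV H').
- exact: (le_trans EU EV EW' UV H').
- exact: (le_trans EUC EVC EW' nUV H').
Qed.

Definition on_side (P : set (set G)) V : Prop := exists2 U, P U & le U V.
Definition on U V : Prop := on_side (bar U) V.

Lemma onE U V : on U V <-> le U V \/ le (~` U) V.
Proof.
split=> [[W [->|->] WV]|[UV|UV]]; [by left|by right| |].
  by exists U => //; left.
by exists (~` U) => //; right.
Qed.

Lemma translates_bar U V : E U -> bar U V -> E V.
Proof. by move=> EU [->|->] //; apply: EC. Qed.

(** If crossing sets were on opposite sides of [V], one of their corners would be
    small. *)
Lemma cross_on U U' V : E U -> E U' -> E V -> cross U U' -> ~ eqv U' V ->
  on U V -> on U' V.
Proof.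
move=> EU EU' EV [c1 c2 c3 c4] nU'V [U0 UU0 U0V].
have EU0 := translates_bar EU UU0; have EUC := EC EU'; have EVC := EC EV.
apply/onE; case: (not_equivalent_nested EU' EV nU'V) => H'; [by left| |by right|].
- have := leC EU' EVC H'; rewrite setCK => /(le_trans EU0 EV EUC U0V).
  by case: UU0 => ->.
- have := leC EUC EVC H'; rewrite !setCK => /(le_trans EU0 EV EU' U0V).
  by case: UU0 => ->.
Qed.

(** A whole component lies on one side of each set outside it. *)
Lemma on_side_connected (P Q : set (set G)) V : E V -> connected H X P Q ->
  ~ connected H X P (bar V) -> on_side P V <-> on_side Q V.
Proof.
move=> EV; elim=> {P Q} [P Q PQ|//|P Q PQ IH nQV|P Q R PQ IH1 QR IH2 nPV].
- have [U [U' [EU EU' eP eQ cr]]] := bar_crossesE PQ; rewrite eP eQ => nUV.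
  have nU'V : ~ eqv U' V.
    by move=> U'V; apply: nUV; apply: equivalent_trans U'V; apply: cross_equivalent.
  split; first exact: cross_on.
  by apply: cross_on => //; apply: cross_sym.
- by apply: iff_sym; apply: IH => PV; apply: nQV; apply: rst_trans PV; apply: rst_sym.
- rewrite IH1 //; apply: IH2 => QV; apply: nPV; exact: rst_trans QV.
Qed.

Lemma on_equivalent U U' V : E V -> eqv U U' -> ~ eqv U V -> on U V <-> on U' V.
Proof. exact: on_side_connected. Qed.

Lemma on_total U V : E U -> E V -> ~ eqv U V -> on U V \/ on U (~` V).
Proof.
move=> EU EV /(not_equivalent_nested EU EV); rewrite !onE.
by case; tauto.
Qed.

Lemma on_exclusive U V : E U -> E V -> ~ eqv U V -> on U V -> ~ on U (~` V).
Proof.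
move=> EU EV nUV; have EUC := EC EU; have EVC := EC EV.
have no W : E W -> ~ eqv W V -> le W V -> le (~` W) (~` V) -> False.
  move=> EW nWV WV /(leC (EC EW) EVC); rewrite !setCK => VW.
  by apply: nWV; apply: mutual_equivalent.
rewrite !onE => -[UV|UV] [UV'|UV'].
- exact: le_consistent UV UV'.
- exact: no UV'.
- by apply: (no (~` U)); rewrite ?setCK ?equivalentCl.
- exact: le_consistent UV UV'.
Qed.

Lemma le_strictly_below U V : E U -> E V -> ~ eqv U V -> le U V ->
  strictly_below s U V.
Proof.
move=> EU EV nUV UV; have EUC := EC EU; have EVC := EC EV; split=> //.
- exact: le_consistent.
- by move=> nU; apply: (on_exclusive EU EV nUV); apply/onE; [left|right].
- move=> nU; have nVU := leC EUC EV nU; rewrite setCK in nVU.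
  have nVV := le_trans EVC EU EV nVU UV.
  by apply: (le_consistent EVC nVV); apply: almost_sub_refl.
Qed.

Lemma on_ltrans g U V : on (ltrans g U) (ltrans g V) <-> on U V.
Proof.
by rewrite !onE -ltransC !almost_sub_ltrans.
Qed.

Local Notation S := (ccc_stab H X).

Lemma translates_act g : E (ltrans g X).
Proof. by apply/translatesP; exists g, true. Qed.

(** Suppose that all other components were on the same side, and let [A] be the
    other side of [X].  A translate of [X] with a boundary point [y] deep in [A]
    cannot have [A] almost on one of its sides, so it is in the component of [X],
    and [y] is in [S x0] for a fixed [x0].  As [A] contains balls of
    arbitrary radius all of whose points are deep, [S x0] contains, up to left
    translation by elements of [S], all balls around [x0], and [S] is [G]. *)
Lemma component_on_each_side a : (exists g, ~ S g) ->
  exists V, [/\ E V, ~ eqv X V & le V (side a X)].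
Proof.
move=> [g0 nSg0]; apply: contrapT => none; apply: nSg0.
set A := side a X; have EA : E A by apply: translates_self.
have EAC := EC EA.
have far_side V : E V -> ~ eqv X V -> le A V \/ le A (~` V).
  move=> EV nXV; have nVA : ~ eqv V A.
    by rewrite equivalent_sider => /equivalent_sym.
  have EVC := EC EV; case: (not_equivalent_nested EV EA nVA) => H'.
  - by case: none; exists V.
  - by right; have := leC EV EAC H'; rewrite setCK.
  - by case: none; exists (~` V); rewrite equivalentCr.
  - by left; have := leC EVC EAC H'; rewrite !setCK.
have [n Hn] := uniform_near gen_s sH aiX gen_r EA.
have [x0 bx0] := boundary_nonempty gen_s ntX.
have deep_in_stab y : A y -> ~ near s n.+1 A y -> S (y * x0^-1).
  move=> Ay far; apply: contrapT => nS; set V := ltrans (y * x0^-1) X.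
  have EV : E V by apply: translates_act.
  have [c Ac] : exists c, le A (side c V).
    by case: (far_side V EV nS); [exists true|exists false].
  have EVc : E (side c V) by case: (c) => //; apply: EC.
  have nAV : ~ eqv A (side c V).
    by rewrite equivalent_sidel equivalent_sider.
  have [d dl ne] : boundary s (side c V) y.
    by rewrite boundary_side boundary_ltrans; apply/ltransE; grp.
  have sb := le_strictly_below EA EVc nAV Ac.
  have Ayd : A (y * d).
    have far1 : ~ near s 1%N A y by move=> nr; apply: far; apply: near_leq nr.
    exact/(far_const far1 (ball_letter dl)).
  have [Vy|nVy] := pselect (side c V y); last first.
    by apply: far; apply: near_leq (Hn _ EVc sb _ Ay nVy).
  have nVyd : ~ side c V (y * d) by move=> Vyd; apply: ne.
  apply: far; rewrite -add1n; apply: near_shift (ball_letter dl) _.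
  exact: Hn _ EVc sb _ Ayd nVyd.
(* The radius is chosen so that the ball around [x0] contains [g0 * x0]. *)
have [R Rball] := in_some_ball gen_s (x0^-1 * g0 * x0).
have [y [Ay fary]] := deep_point gen_s sH aiX ntX (R + n.+1) EA.
have Sy : S (y * x0^-1).
  by apply: deep_in_stab => // nr; apply: fary; apply: near_leq nr; rewrite leq_addl.
have : S (y * x0^-1 * g0).
  have -> : y * x0^-1 * g0 = y * (x0^-1 * g0 * x0) * x0^-1 by grp.
  apply: deep_in_stab.
    have farR : ~ near s R A y.
      by move=> nr; apply: fary; apply: near_leq nr; rewrite leq_addr.
    exact/(far_const farR Rball).
  by move=> nr; apply: fary; apply: near_shift nr.
move=> Syg; rewrite -[g0](mulKg (y * x0^-1)).
have sS := is_subgroup_ccc_stab H X; apply: subgroupM => //.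
exact: subgroupV.
Qed.

(** Take a translate on each side of [X].  One of the two, or if both reverse the
    sides their composition, moves a side of [X] into itself. *)
Lemma hyperbolic_translate : (exists g, ~ S g) ->
  exists b a, ~ S a /\ le (ltrans a (side b X)) (side b X).
Proof.
move=> nS.
have [_ [/translatesP[g1 [c1 ->]]]] := component_on_each_side true nS.
rewrite equivalent_sider /= => nS1 le1.
have [_ [/translatesP[g2 [c2 ->]]]] := component_on_each_side false nS.
rewrite equivalent_sider /= => nS2 le2.
case: c1 le1 => /= le1; first by exists true, g1.
case: c2 le2 => /= le2; last by exists false, g2; rewrite /= ltransC.
have E1 := translates_act g1; have E2 := translates_act g2.
have E21 := translates_act (g2 * g1).
have EX : E X := translates_self X true; have EXC := EC EX; have E21C := EC E21.
have le21 : le (~` ltrans (g2 * g1) X) (ltrans g2 X).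
  by rewrite -ltransM -ltransC; apply/almost_sub_ltrans.
exists false, (g2 * g1); split=> /=; last first.
  by rewrite ltransC; apply: (le_trans E21C E2 EXC).
move=> S21; have nX2 : ~ eqv X (ltrans g2 X) by [].
have on2 : on X (ltrans g2 X).
  by apply/(on_equivalent E2 S21 nX2)/onE; right.
apply: (on_exclusive EX E2 nX2 on2); apply/onE; left.
by have := leC E2 EXC le2; rewrite setCK.
Qed.

(** The members of the components lying, as seen from [P], in the same direction
    as [R]. *)
Definition direction P R : set (set G) :=
  [set W | ~ eqv W P /\ forall V, E V -> eqv V P -> on W V <-> on R V].

Lemma direction_equivalent P R W W' : eqv W W' ->
  direction P R W -> direction P R W'.
Proof.
move=> WW' [nWP WR]; have nW'P : ~ eqv W' P.
  by move=> W'P; apply: nWP; apply: equivalent_trans W'P.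
split=> // V EV VP; rewrite -(WR V EV VP); apply: iff_sym.
apply: on_equivalent => // WV; apply: nWP; exact: equivalent_trans VP.
Qed.

Lemma direction_base P P' R : eqv P P' -> direction P R `<=` direction P' R.
Proof.
move=> PP' W [nWP WR]; split=> [WP'|V EV VP'].
  apply: nWP; apply: (equivalent_trans WP'); exact: equivalent_sym.
apply: WR => //; apply: (equivalent_trans VP'); exact: equivalent_sym.
Qed.

Lemma direction_eq P R W : direction P R W -> direction P R = direction P W.
Proof.
move=> [_ WR]; apply/seteqP; split=> W' [nW'P W'R]; split=> // V EV VP.
  by rewrite W'R // WR.
by rewrite W'R // WR.
Qed.

Lemma direction_self P R : ~ eqv R P -> direction P R R.
Proof. by []. Qed.

Lemma direction_ltrans g P R W :
  direction (ltrans g P) (ltrans g R) (ltrans g W) <-> direction P R W.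
Proof.
have sub h P' R' W' : direction P' R' W' ->
    direction (ltrans h P') (ltrans h R') (ltrans h W').
  move=> [nWP WR]; split=> [/equivalent_ltransI//|V EV VP].
  rewrite -[V](ltransVK h^-1) invgK !on_ltrans; apply: WR.
    exact: translates_ltrans.
  by apply: (@equivalent_ltransI _ _ _ h); rewrite ltransM mulgV ltrans1.
split; last exact: sub.
by move=> /(sub g^-1); rewrite !ltransVK.
Qed.

(** Suppose that [W] were in neither.  Some [V] in the component of [P] has [W] on
    one side and [Q] on the other, and some [V'] in the component of [Q] has [W] on
    one side and [P] on the other.  Then [V] and [V'] are almost disjoint, while
    [W] or its complement is almost contained in each of them; every combination
    contradicts nontriviality or makes [V] and [V'] equivalent. *)
Lemma directions_cover P Q W : E P -> E Q -> E W -> ~ eqv P Q ->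
  direction P Q W \/ direction Q P W.
Proof.
move=> EP EQ EW nPQ; have nQP : ~ eqv Q P by move=> /equivalent_sym.
have [|nd] := pselect (direction P Q W); [by left|right].
have [WP|nWP] := pselect (eqv W P).
  by apply: direction_equivalent (direction_self nPQ); apply: equivalent_sym.
have separate P' Q' : E P' -> E Q' -> ~ eqv Q' P' -> ~ eqv W P' -> ~ direction P' Q' W ->
    exists V, [/\ E V, eqv V P', on W V & on Q' (~` V)].
  move=> EP' EQ' nQP' nWP' nd'; apply: contrapT => none; apply: nd'; split=> // V EV VP.
  have nV Y : ~ eqv Y P' -> ~ eqv Y V.
    by move=> nY YV; apply: nY; apply: equivalent_trans VP.
  split=> onV; apply: contrapT => noV; apply: none.
    exists V; split=> //.
    by case: (on_total EQ' EV (nV _ nQP')).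
  exists (~` V); split; rewrite ?setCK ?equivalentCl //; first exact: EC.
  by case: (on_total EW EV (nV _ nWP')).
have [V [EV VP WV QV]] := separate P Q EP EQ nQP nWP nd.
have nV Y : ~ eqv Y P -> ~ eqv Y V.
  by move=> nY YV; apply: nY; apply: equivalent_trans VP.
have EVC := EC EV.
have nWQ : ~ eqv W Q.
  move=> WQ; apply: (on_exclusive EW EV (nV _ nWP) WV).
  apply/(on_equivalent EVC WQ) => //; rewrite equivalentCr; exact: nV.
apply: contrapT => nd'.
have [V' [EV' VQ' WV' PV']] := separate Q P EQ EP nPQ nWQ nd'.
have EVC' := EC EV'.
have nVV' : ~ eqv V V'.
  move=> VV'; apply: nPQ; apply: (equivalent_trans (equivalent_sym VP)).
  exact: equivalent_trans VQ'.
have onV' : on V' (~` V).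
  apply/(on_equivalent EVC VQ'); rewrite ?equivalentCr //.
  by move=> /equivalent_sym.
have onV : on V (~` V').
  by apply/(on_equivalent EVC' VP); rewrite ?equivalentCr.
have V'V : le V' (~` V).
  move/onE: onV' => [//|V'V]; move/onE: onV => [VV'|VV'].
    by have := leC EV EVC' VV'; rewrite setCK.
  case: nVV'; have := mutual_equivalent EVC EVC' VV' V'V.
  by rewrite equivalentCl equivalentCr.
have VV' := leC EV' EVC V'V; rewrite setCK in VV'.
have opposite U : E U -> le U V -> le (~` U) V' -> False.
  move=> EU UV UV'; have := leC (EC EU) EV' UV'; rewrite setCK => V'U.
  apply: nVV'; have := mutual_equivalent EV EVC' VV' (le_trans EVC' EU EV V'U UV).
  by rewrite equivalentCr.
have EWC := EC EW.
move: WV WV'; rewrite !onE => -[WV|WV] [WV'|WV'].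
- exact: le_consistent WV' (le_trans EW EV EVC' WV VV').
- exact: opposite WV WV'.
- by apply: (opposite (~` W)); rewrite ?setCK.
- exact: le_consistent WV' (le_trans EWC EV EVC' WV VV').
Qed.

Section Splitting.
Variables (b : bool) (a : G).
Hypothesis nSa : ~ S a.
Hypothesis hyperbolic : le (ltrans a (side b X)) (side b X).

Let EX g : E (ltrans g X) := translates_act g.

Let dir g x : set G := [set y | direction (ltrans g X) (ltrans x X) (ltrans y X)].

Let dir_ltrans g x : ltrans g (dir 1 x) = dir g (g * x).
Proof.
have e y := direction_ltrans g (ltrans 1 X) (ltrans x X) (ltrans (g^-1 * y) X).
by apply/seteqP; split=> y; rewrite ltransE /dir /= -e !ltransM mulg1 mulVKg.
Qed.

Let C : set G := dir 1 a.

Let translateC g : ltrans g C = dir g (g * a).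
Proof. exact: dir_ltrans. Qed.

Let eqvE g h : eqv (ltrans g X) (ltrans h X) <-> S (g^-1 * h).
Proof.
rewrite /ccc_stab /= -ltransM; split=> [/(equivalent_ltrans g^-1)|].
  by rewrite ltransVK.
by move=> /(equivalent_ltrans g); rewrite ltransM mulgV ltrans1.
Qed.

Let dir_base g h x : S (g^-1 * h) -> dir g x = dir h x.
Proof.
move=> /eqvE gh; apply/seteqP.
by split=> y; apply: direction_base => //; apply: equivalent_sym.
Qed.

Let dir_eq g x y : dir g x y -> dir g x = dir g y.
Proof. by move=> d; apply/seteqP; split=> z; rewrite /dir /= (direction_eq d). Qed.

Let dir_self g x : ~ S (g^-1 * x) -> dir g x x.
Proof.
by move=> nS; apply: direction_self => /equivalent_sym/eqvE.
Qed.

Let dir_cover g h x : ~ S (g^-1 * h) -> dir g h x \/ dir h g x.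
Proof.
by move=> nS; apply: directions_cover => // /eqvE.
Qed.

Let dir_near g x y : dir g x y -> ~ S (g^-1 * y).
Proof. by move=> [nyg _] /eqvE /equivalent_sym /nyg. Qed.

(** A direction containing [x] but not [y] is seen from the component of [y], or
    from a component with a member strictly between [x] and [y]; [between_finite]
    leaves finitely many components, and each has one direction containing
    [x]. *)
Lemma direction_finite x y : exists l : seq G,
  forall g, ltrans g C x -> ~ ltrans g C y ->
    exists2 g', g' \in l & ltrans g C = ltrans g' C.
Proof.
have Eside c g : E (side c (ltrans g X)) by apply/translatesP; exists g, c.
have [L HL] : exists L : seq G, forall g c d e,
    strictly_below s (side d (ltrans x X)) (side c (ltrans g X)) ->
    strictly_below s (side c (ltrans g X)) (side e (ltrans y X)) ->
  exists2 f, f \in L & ltrans g X = ltrans f X.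
  have fin d e := between_finite gen_s sH aiX ntX gen_r (Eside d x) (Eside e y).
  have [l1 H1] := fin true true; have [l2 H2] := fin true false.
  have [l3 H3] := fin false true; have [l4 H4] := fin false false.
  exists (l1 ++ l2 ++ l3 ++ l4) => g c d e sb1 sb2.
  have [f fl ->] : exists2 f, f \in if d then (if e then l1 else l2)
      else (if e then l3 else l4) & ltrans g X = ltrans f X.
    by case: d e sb1 sb2 => -[] sb1 sb2; eauto.
  by exists f => //; move: fl; rewrite !mem_cat; case: (d); case: (e) => ->; rewrite ?orbT.
(* [g X] is in the component of [f X] for some [f] in a fixed finite list. *)
have owner g : ltrans g C x -> ~ ltrans g C y ->
    exists2 f, f \in y :: L & S (g^-1 * f).
  rewrite translateC => gx ngy.
  have [Sgy|nSgy] := pselect (S (g^-1 * y)); first by exists y; rewrite ?inE ?eqxx.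
  have ngx := dir_near gx; rewrite (dir_eq gx) in ngy.
  have nV z V : eqv V (ltrans g X) -> ~ S (g^-1 * z) -> ~ eqv (ltrans z X) V.
    move=> Vg nSz zV; apply: nSz; apply/eqvE/equivalent_sym.
    exact: equivalent_trans zV Vg.
  have [V [EV Vg xV yV]] : exists V, [/\ E V, eqv V (ltrans g X),
      on (ltrans x X) V & on (ltrans y X) (~` V)].
    apply: contrapT => none; apply: ngy; split=> [/equivalent_sym/eqvE//|V EV Vg].
    split=> onV; apply: contrapT => noV; apply: none; last first.
      by exists V; split=> //; case: (on_total (EX y) EV (nV _ _ Vg nSgy)).
    exists (~` V); split; rewrite ?setCK ?equivalentCl //; first exact: EC.
    by case: (on_total (EX x) EV (nV _ _ Vg ngx)).
  have [h [c eV]] := (translatesP X V).1 EV.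
  have pick z U : on (ltrans z X) U -> exists d, le (side d (ltrans z X)) U.
    by move=> /onE[?|?]; [exists true|exists false].
  have [d xd] := pick _ _ xV; have [e ye] := pick _ _ yV.
  have EVC := EC EV.
  have Ve : le V (side (~~ e) (ltrans y X)).
    by have := leC (Eside e y) EVC ye; rewrite setCK sideC.
  have nxV := nV _ _ Vg ngx; have nyV := nV _ _ Vg nSgy.
  have [f fL ef] : exists2 f, f \in L & ltrans h X = ltrans f X.
    apply: (HL h c d (~~ e)); rewrite -eV.
      by apply: le_strictly_below => //; rewrite equivalent_sidel.
    apply: le_strictly_below => //; rewrite equivalent_sider.
    by move=> /equivalent_sym.
  exists f; first by rewrite inE fL orbT.
  apply/eqvE; rewrite -ef; apply: equivalent_sym.
  by move: Vg; rewrite eV equivalent_sidel.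
(* For each [f], one direction containing [x] seen from the component of [f X]. *)
have [rep Hrep] : {rep : G -> G & forall f g, S (g^-1 * f) -> ltrans g C x ->
    ltrans (rep f) C x /\ S ((rep f)^-1 * f)}.
  have ex f : exists g', forall g, S (g^-1 * f) -> ltrans g C x ->
      ltrans g' C x /\ S (g'^-1 * f).
    have [[g' [Sg' g'x]]|none] := pselect (exists g', S (g'^-1 * f) /\ ltrans g' C x).
      by exists g'.
    by exists 1 => g Sg gx; case: none; exists g.
  by exists (fun f => sval (cid (ex f))) => f; case: cid.
exists [seq rep f | f <- y :: L] => g gx ngy.
have [f fL Sgf] := owner g gx ngy; exists (rep f); first exact: map_f.
have [repx Srep] := Hrep f g Sgf gx.
rewrite !translateC in gx repx *; rewrite (dir_eq gx) (dir_eq repx).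
by rewrite (dir_base _ Sgf) (dir_base _ Srep).
Qed.

(** The direction from [X] towards [a X] satisfies the nestedness hypotheses of
    the previous part, and [a] moves it properly: [a^-1 X] and [a X] are on
    different sides of [X], so that one is in the direction and the other is not. *)
Lemma splits_over_subgroup_of_ccc_stab :
  exists K : set G, [/\ is_subgroup K, K `<=` S & splits_over K].
Proof.
have sS := is_subgroup_ccc_stab H X.
have SV g : S g^-1 <-> S g.
  by split=> Sg; [rewrite -[g]invgK|]; apply: subgroupV.
have nS1 g : ~ S g -> ~ S (1^-1 * g) by rewrite invg1 mul1g.
have nSg1 g : ~ S g -> ~ S (g^-1 * 1) by rewrite mulg1 SV.
have CE g : C g -> C = dir 1 g by apply: dir_eq.
have CVE g : C g^-1 <-> ltrans g C 1 by rewrite ltransE mulg1.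
have nSC g : C g -> ~ S g by move=> /dir_near; rewrite invg1 mul1g.
have CS g t : C g -> S t -> C (g * t).
  move=> Cg St; apply: direction_equivalent Cg; apply/eqvE.
  by rewrite mulKg.
have same_owner g : S g -> ltrans g C = C \/ (forall x, C x -> ~ ltrans g C x).
  move=> Sg; have [[x [Cx gx]]|none] := pselect (exists x, C x /\ ltrans g C x).
    left; rewrite translateC in gx *; rewrite (dir_eq gx) (CE x Cx).
    by apply: dir_base; rewrite mulg1 SV.
  by right=> x Cx gx; apply: none; exists x.
have facing g : C g -> C g^-1 -> forall x, C x \/ ltrans g C x.
  move=> Cg /CVE; rewrite translateC => g1 x; rewrite (dir_eq g1) (CE g Cg).
  by apply: dir_cover; apply/nS1/nSC.
have following g : ~ S g -> C g -> ~ C g^-1 -> ltrans g C `<=` C.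
  move=> nSg Cg nCgV x; rewrite translateC => gx; apply: contrapT => nCx.
  apply: nCgV; apply/CVE; rewrite translateC (dir_eq gx).
  case: (dir_cover x (nS1 _ nSg)) => [Cx|g1x]; first by case: nCx; rewrite (CE g Cg).
  by rewrite -(dir_eq g1x); apply/dir_self/nSg1.
have back_to_back g : ~ S g -> ~ C g -> ~ C g^-1 -> forall x, C x -> ~ ltrans g C x.
  move=> nSg nCg nCgV x Cx; rewrite translateC => gx.
  case: (dir_cover x (nS1 _ nSg)) => [C'x|g1x].
    by apply: nCg; rewrite (CE x Cx) -(dir_eq C'x); apply/dir_self/nS1.
  apply: nCgV; apply/CVE; rewrite translateC (dir_eq gx) -(dir_eq g1x).
  exact/dir_self/nSg1.
have Ca : C a by apply/dir_self/nS1.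
have nCaV : ~ C a^-1.
  set U := side b X; have EU : E U by apply: translates_self.
  have EaU : E (ltrans a^-1 U) by apply: translates_ltrans.
  have UX : eqv U (ltrans 1 X) by rewrite ltrans1 equivalent_sidel; apply: equivalent_refl.
  have on_bar g V : on (ltrans g (side b X)) V <-> on (ltrans g X) V.
    by rewrite ltrans_side; case: (b); rewrite /on /= ?barC.
  move=> [naX /(_ U EU UX)[_ H']].
  have aU : on (ltrans a X) U by apply/on_bar/onE; left.
  have nUa : ~ eqv (ltrans a^-1 X) U.
    by move=> aVU; apply: naX; apply: equivalent_trans UX.
  apply: (on_exclusive (EX a^-1) EU nUa (H' aU)); apply/on_bar/onE; right.
  apply: leC => //; apply/(almost_sub_ltrans s a).
  by rewrite ltransM mulgV ltrans1.
exists (direction_stab C); split.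
- exact: is_subgroup_direction_stab.
- exact: (direction_stab_sub sS nSC back_to_back Ca).
- exact: (splits_over_direction_stab sS CS nSC same_owner facing following
    back_to_back direction_finite Ca nCaV).
Qed.

End Splitting.

End Pretree.

(** * Sets associated to a splitting *)

Section AssociatedSets.
Variable G : groupType.
Implicit Types (A Z : set G) (D : splitting_data G).

Lemma ltrans_subgroup A k : is_subgroup A -> A k -> ltrans k A = A.
Proof.
move=> sA Ak; apply/seteqP; split=> x; first by move=> [a Aa <-]; apply: subgroupM.
by move=> Ax; apply/ltransE; apply: subgroupM => //; apply: subgroupV.
Qed.

Lemma splitting_edge_group D : is_splitting D -> is_subgroup (edge_group D).
Proof. by case: D => [A B K [[[? ? ?]]]|A K t [[]]]. Qed.

Lemma edge_endM D k b g : edge_end D b (k * g) = act_vertex k (edge_end D b g).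
Proof.
by case: D => [A B K|A K t]; case: b; rewrite /act_vertex /= !ltransM ?mulgA.
Qed.

Lemma edge_end_coset D b g k : is_splitting D -> edge_group D k ->
  edge_end D b (g * k) = edge_end D b g.
Proof.
case: D => [A B K [[[sA sB sK] [KA KB _]] _ _]|A K t [[sA sK KA KtA] _]] /= Kk.
  case: b; first by rewrite -ltransM (ltrans_subgroup sB (KB _ Kk)).
  by rewrite -ltransM (ltrans_subgroup sA (KA _ Kk)).
case: b; last by rewrite -ltransM (ltrans_subgroup sA (KA _ Kk)).
have -> : g * k * t = g * t * (k ^ t) by rewrite conjgE; grp.
by rewrite -ltransM (ltrans_subgroup sA (KtA _ Kk)).
Qed.

Lemma edge_stab_end D b g k : is_splitting D -> edge_stab D g k ->
  act_vertex k (edge_end D b g) = edge_end D b g.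
Proof.
move=> spD; rewrite /edge_stab /edge /= ltransM => kg.
have : ltrans g (edge_group D) (k * g).
  rewrite -kg; apply/ltransE; rewrite mulVg.
  exact: subgroup1 (splitting_edge_group spD).
move=> /ltransE Kg; rewrite -edge_endM -[k * g](mulVKg g).
exact: edge_end_coset.
Qed.

(** The stabiliser of an edge preserves the paths avoiding that edge and fixes
    both of its ends. *)
Lemma half_tree_edge_stab D g b k v : is_splitting D -> edge_stab D g k ->
  half_tree D g b v -> half_tree D g b (act_vertex k v).
Proof.
move=> spD kg; rewrite /half_tree /= => path.
have fix_end := edge_stab_end b spD kg.
rewrite -fix_end; elim: path => {v} [u w [h [c [hg -> ->]]]|u|u w z _ + _].
- apply: rt_step; exists (k * h), c; rewrite !edge_endM; split=> // kh.
  have kM x : edge D (k * x) = ltrans k (edge D x) by rewrite /edge ltransM.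
  have kgE : ltrans k (edge D g) = edge D g := kg.
  by apply: hg; rewrite -[LHS](ltransVK k) -kM kh -[in LHS]kgE ltransVK.
- exact: rt_refl.
- exact: rt_trans.
Qed.

Lemma associated_stab D Z k : is_splitting D -> associated D Z ->
  edge_group D k -> ltrans k Z = Z.
Proof.
move=> spD [g [b [c [stabE ZE]]]] Kk; have sK := splitting_edge_group spD.
set Zs : set G := [set x | half_tree D g b (act_vertex x (edge_end D c g))] in ZE.
have fixZ h : edge_group D h -> Zs `<=` ltrans h Zs.
  move=> Kh x Zx; apply/ltransE; rewrite /Zs /= -edge_endM -mulgA edge_endM edge_endM.
  apply: half_tree_edge_stab => //; rewrite stabE; exact: subgroupV.
have e : ltrans k Zs = Zs.
  apply/seteqP; split; last exact: fixZ.
  move=> x /ltransE/(fixZ k^-1 (subgroupV sK Kk))/ltransE.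
  by rewrite invgK mulVKg.
by case: ZE => ->; rewrite ?ltransC e.
Qed.

End AssociatedSets.

Theorem corollary6p14 (G : groupType) (H X S : set G) :
  fin_gen [set: G]%classic ->
  is_subgroup H -> fin_gen H ->
  almost_invariant H X -> nontrivial_over H X ->
  is_S H X S -> S <> [set: G]%classic ->
  exists K : set G, [/\ is_subgroup K, (K `<=` S)%classic & splits_over K].
Proof.
move=> [s gen_s] sH [r gen_r] aiX ntX.
case=> [[crossed ->]|[_ [D [Z [spD asD _ _ ->]]]]] nG.
- have [g nSg] : exists g, ~ ccc_stab H X g.
    apply: contrapT => none; apply: nG; apply/seteqP; split=> // g _.
    by apply: ccc_stab_sub; apply: contrapT => nSg; apply: none; exists g.
  have [b [a [nSa hyp]]] := hyperbolic_translate (esym gen_s) sH aiX ntX gen_r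
    crossed (ex_intro _ g nSg).
  have [K [sK KS spK]] := splits_over_subgroup_of_ccc_stab (esym gen_s) sH aiX ntX
    gen_r crossed nSa hyp.
  exists K; split=> // k Kk; apply: ccc_stab_sub; exact: KS.
- exists (edge_group D); split; first exact: splitting_edge_group.
    move=> k Kk; apply: ccc_stab_sub.
    by rewrite /ccc_stab /= (associated_stab spD asD Kk); apply: equivalent_refl.
  by exists D.
Qed.
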